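(* Let $X$ be a Feller process in $\mathbb{R}^n$ satisfying Assumption A with transition density $p_t(x,y)$ (see context), and let $D\subset\mathbb{R}^n$. Assume that there exists some $\varpi$ in the Kato class $\mathcal{S}_K$ with respect to $p_t(x,y)$ such that $\operatorname{supp}\varpi=\overline{D}$. Then the set $D$ is non-polar for $X$, i.e. $$\mathbb{P}^x(\tau_D<\infty)>0\qquad\text{for all }x\in\mathbb{R}^n,$$ where $\tau_D:=\inf\{t>0 : X_t\in D\}$.
   Context: Setting (the process $X$). Let $\mu$ be a non-zero Lévy measure on $\mathbb{R}^n\setminus\{0\}$, i.e. $\int(1\wedge|h|^2)\,\mu(dh)<\infty$, let $a:\mathbb{R}^n\to\mathbb{R}^n$ and $m:\mathbb{R}^n\times\mathbb{R}^n\to(0,\infty)$ be measurable, and for $f\in C^2_\infty(\mathbb{R}^n)$ ($C^2$-functions vanishing at infinity with all derivatives up to order 2) set $$\mathcal{L}f(x)=a(x)\cdot\nabla f(x)+\int_{\mathbb{R}^n\setminus\{0\}}\big(f(x+h)-f(x)-h\cdot\nabla f(x)\mathbf 1_{(0,1)}(|h|)\big)m(x,h)\,\mu(dh).$$ Put $q^U(\xi)=\int((\xi\cdot h)^2\wedge1)\,\mu(dh)$, $q^L(\xi)=\int_{0<|\xi\cdot h|\le1}(\xi\cdot h)^2\,\mu(dh)$, and $q^*(r)=\sup_{\ell}q^U(r\ell)$, the supremum being over the unit sphere of $\mathbb{R}^n$. Assumption A. (1) There is $\kappa\ge1$ such that $q^*(r)\le\kappa\inf_{|\ell|=1}q^L(r\ell)$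 for all $r\ge1$; with this $\kappa$ one sets $\alpha:=2/\kappa$. (2) There are constants $c_1,c_2,c_3>0$ with $|a(x)|\le c_1$ and $c_2\le m(x,h)\le c_3$. (3) $a(x)$ and $m(x,h)$ are locally Hölder continuous in $x$ with some index $\lambda\in(0,1]$. (4) Either $\alpha>1$, or $a\equiv0$, $m(x,h)=m(x,-h)$ and $\mu(dh)=\mu(-dh)$. Under Assumption A it is known that $\mathcal{L}$ extends to the generator of a (strong) Feller process $X=(X_t)_{t\ge0}$ in $\mathbb{R}^n$ with $\mathbb{P}^x(X_t\in dy)=p_t(x,y)\,dy$, where $p_t(x,y)$ is continuous on $[t_0,\infty)\times\mathbb{R}^n\times\mathbb{R}^n$ for each $t_0>0$ and, for $t\in(0,1]$, $x,y\in\mathbb{R}^n$, $$\rho_t^n f_{\rm low}((y-x)\rho_t)\le p_t(x,y)\le\rho_t^n\big(f_{\rm up}(\rho_t\,\cdot)*Q_t\big)(y-x),$$ with $\rho_t=\inf\{r>0:q^*(r)\ge1/t\}$, $f_{\rm low}(z)=a_1(1-a_2|z|)_+$, $f_{\rm up}(z)=a_3e^{-a_4|z|}$, constants $a_i>0$, and sub-probability measures $Q_t$. Here $\overline{D}$ is the topological closure of $D$. Kato class: a Borel measure $\varpi$ on $\mathbb{R}^n$ belongs to $\mathcal{S}_K$ with respect to $p_t(x,y)$ if $\lim_{t\to0}\sup_{x\in\mathbb{R}^n}\int_0^t\int_{\mathbb{R}^n}p_s(x,y)\,\varpi(dy)\,ds=0$. A Borel set $D$ is polar for $X$ if $\mathbb{P}^x(\tau_D<\infty)=0$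 for all $x\in\mathbb{R}^n$.
   Formalization: The set D is additionally assumed non-empty and the measure ϖ is assumed to be carried by D (the complement of D is ϖ-null, automatic for closed D); without these the claim fails, e.g. for D = Q² with ϖ Lebesgue measure and a planar stable process. *)

(* Defs.v *)
From HB Require Import structures.
From mathcomp Require Import all_boot all_order all_algebra.
From mathcomp Require Import all_classical all_reals all_analysis.
From mathcomp Require Import measurable_realfun.

Set Implicit Arguments.
Unset Strict Implicit.
Unset Printing Implicit Defensive.

Import Order.TTheory GRing.Theory Num.Theory.
Import numFieldNormedType.Exports.

Local Open Scope classical_set_scope.
Local Open Scope ring_scope.

(* R^n is 'rV[R]_n. Its library norm is the sup norm (which gives the usual
   topology); it carries no measurable structure in the library, so we equip
   it with its Borel sigma-algebra. *)
HB.instance Definition _ (R : realType) (m n : nat) :=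
  @isMeasurable.Build (sigma_display (@open 'M[R]_(m, n)))
    'M[R]_(m, n) <<s (@open 'M[R]_(m, n)) >>
    (@sigma_algebra0 _ setT _) (@sigma_algebraC _ _)
    (@sigma_algebra_bigcup _ setT _).

Section Euclidean.
Context (R : realType) (n : nat).
Implicit Types x y : 'rV[R]_n.

Definition dot x y : R := \sum_(i < n) x 0 i * y 0 i.

Definition enorm x : R := Num.sqrt (dot x x).

Definition punctured : set 'rV[R]_n := ~` [set 0].

Definition sphere : set 'rV[R]_n := [set l | enorm l = 1].

(* This property determines n-dimensional Lebesgue measure uniquely among the
   Borel measures on R^n. *)
Definition is_lebesgue (leb : {measure set 'rV[R]_n -> \bar R}) : Prop :=
  forall u v : 'rV[R]_n, (forall i, u 0 i <= v 0 i) ->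
    leb [set x | forall i, u 0 i < x 0 i <= v 0 i]
      = (\prod_(i < n) (v 0 i - u 0 i))%:E.

Definition msupport (w : {measure set 'rV[R]_n -> \bar R}) : set 'rV[R]_n :=
  [set x | forall U, open U -> U x -> (0 < w U)%E].

End Euclidean.
Arguments sphere {R n}.
Arguments punctured {R n}.

Section FunctionSpaces.
Context (R : realType) (n : nat).
Implicit Types f : 'rV[R]_n -> R.

Definition C0 f : Prop :=
  continuous f /\
  (forall e : R, 0 < e -> exists r : R, forall x, r < enorm x -> `|f x| < e).

Definition partial (i : 'I_n) f : 'rV[R]_n -> R :=
  fun x => 'D_(delta_mx 0 i) f x.

Definition grad f (x : 'rV[R]_n) : 'rV[R]_n := \row_i partial i f x.

Definition has_partials f : Prop :=
  forall i x, derivable f x (delta_mx 0 i).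

Definition C2_infty f : Prop :=
  [/\ C0 f,
      has_partials f,
      (forall i, C0 (partial i f)),
      (forall i, has_partials (partial i f)) &
      (forall i j, C0 (partial j (partial i f)))].

End FunctionSpaces.

(* A measure on R^n \ {0} is a measure on R^n that does not charge {0}. *)
Section Operator.
Context (R : realType) (n : nat).
Variable mu : {measure set 'rV[R]_n -> \bar R}.
Implicit Types (x h xi : 'rV[R]_n) (r t : R).

Definition levy_measure : Prop :=
  mu [set 0] = 0%E /\
  (\int[mu]_(h in punctured) (Num.min 1 (enorm h ^+ 2))%:E < +oo)%E.

Definition levy_op (a : 'rV[R]_n -> 'rV[R]_n) (m : 'rV[R]_n -> 'rV[R]_n -> R)
    (f : 'rV[R]_n -> R) x : R :=
  dot (a x) (grad f x) +
  \int[mu]_(h in punctured)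
    ((f (x + h) - f x - dot h (grad f x) * \1_(`]0, 1[) (enorm h)) * m x h).

Definition qU xi : \bar R :=
  \int[mu]_(h in punctured) (Num.min (dot xi h ^+ 2) 1)%:E.

Definition qL xi : \bar R :=
  \int[mu]_(h in [set h | 0 < `|dot xi h| <= 1]) (dot xi h ^+ 2)%:E.

Definition qstar r : \bar R := ereal_sup [set qU (r *: l) | l in sphere].

Definition rho t : R := inf [set r | 0 < r /\ ((t^-1)%:E <= qstar r)%E].

Definition loc_holder (a : 'rV[R]_n -> 'rV[R]_n)
    (m : 'rV[R]_n -> 'rV[R]_n -> R) (lambda : R) : Prop :=
  forall r, exists C : R, forall x y, enorm x <= r -> enorm y <= r ->
    enorm (a x - a y) <= C * enorm (x - y) `^ lambda /\
    (forall h, `|m x h - m y h| <= C * enorm (x - y) `^ lambda).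

Definition assumptionA (a : 'rV[R]_n -> 'rV[R]_n)
    (m : 'rV[R]_n -> 'rV[R]_n -> R) : Prop :=
  exists kappa : R, let alpha := 2 / kappa in
  [/\ 1 <= kappa /\
      (forall r, 1 <= r ->
        (qstar r <= kappa%:E * ereal_inf [set qL (r *: l) | l in sphere])%E),
      (exists c1 c2 c3 : R,
        [/\ 0 < c1, 0 < c2, 0 < c3, (forall x, enorm (a x) <= c1) &
            forall x h, c2 <= m x h <= c3]),
      (exists lambda : R, 0 < lambda <= 1 /\ loc_holder a m lambda) &
      1 < alpha \/
      [/\ forall x, a x = 0,
          forall x h, m x h = m x (- h) &
          forall B : set 'rV[R]_n, measurable B ->
            mu [set h : 'rV[R]_n | B (- h)] = mu B]].

Definition f_low (a1 a2 : R) (z : 'rV[R]_n) : R :=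
  a1 * Num.max (1 - a2 * enorm z) 0.

Definition f_up (a3 a4 : R) (z : 'rV[R]_n) : R := a3 * expR (- a4 * enorm z).

(* The integral is the convolution (f_up (rho_t .) * Q_t) (y - x). *)
Definition density_bounds (p : R -> 'rV[R]_n -> 'rV[R]_n -> R) : Prop :=
  exists (a1 a2 a3 a4 : R) (Q : R -> subprobability 'rV[R]_n R),
    [/\ 0 < a1, 0 < a2, 0 < a3, 0 < a4 &
    forall t x y, 0 < t <= 1 ->
      rho t ^+ n * f_low a1 a2 (rho t *: (y - x)) <= p t x y /\
      ((p t x y)%:E <= (rho t ^+ n)%:E *
         \int[Q t]_z (f_up a3 a4 (rho t *: (y - x - z)))%:E)%E].

End Operator.

(* Processes are indexed by R, and only times t >= 0 are meaningful. *)
Section Process.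
Context (R : realType) (n : nat) (d : measure_display).
Context (Omega : measurableType d).
Variables (P : 'rV[R]_n -> probability Omega R).
Variables (X : R -> Omega -> 'rV[R]_n).

Definition natural_filtration (s : R) : set (set Omega) :=
  <<s [set A | exists u B, [/\ 0 <= u <= s, measurable B & A = X u @^-1` B]] >>.

Definition cadlag : Prop :=
  forall omega t, 0 <= t ->
    X s omega @[s --> t^'+] --> X t omega /\
    (0 < t -> cvg (X s omega @[s --> t^'-])).

Definition markov_process : Prop :=
  [/\ forall t, 0 <= t -> measurable_fun setT (X t),
      forall x, P x (X 0 @^-1` [set x]) = 1%E,
      forall t B, 0 <= t -> measurable B ->
        measurable_fun setT (fun x => P x (X t @^-1` B)) &
      forall x s t A B, 0 <= s -> 0 <= t ->
        natural_filtration s A -> measurable B ->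
        P x (A `&` X (s + t) @^-1` B)
          = (\int[P x]_(omega in A) P (X s omega) (X t @^-1` B))%E].

Definition semigroup (t : R) (f : 'rV[R]_n -> R) (x : 'rV[R]_n) : R :=
  \int[P x]_omega f (X t omega).

Definition feller_process : Prop :=
  [/\ markov_process,
      cadlag,
      forall t f, 0 <= t -> C0 f -> C0 (semigroup t f) &
      forall f, C0 f -> forall e, 0 < e ->
        \forall t \near 0^'+, forall x, `|semigroup t f x - f x| < e].

(* f is in the domain of the C_0-generator, which maps it to g *)
Definition generator (f g : 'rV[R]_n -> R) : Prop :=
  [/\ C0 f, C0 g &
      forall e, 0 < e -> \forall t \near 0^'+, forall x,
        `|t^-1 * (semigroup t f x - f x) - g x| < e].

Definition transition_density (leb : {measure set 'rV[R]_n -> \bar R})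
    (p : R -> 'rV[R]_n -> 'rV[R]_n -> R) : Prop :=
  (forall t x B, 0 < t -> measurable B ->
    P x (X t @^-1` B) = (\int[leb]_(y in B) (p t x y)%:E)%E) /\
  (forall t0, 0 < t0 ->
    {within [set z : R * 'rV[R]_n * 'rV[R]_n | t0 <= z.1.1],
      continuous (fun z : R * 'rV[R]_n * 'rV[R]_n => p z.1.1 z.1.2 z.2)}).

(* For a Borel set D the event [hitting_time D < +oo] is in general only
   measurable for the completion of P x; its probability is then given by the
   outer measure (P x)^*%mu. *)
Definition hitting_time (D : set 'rV[R]_n) (omega : Omega) : \bar R :=
  ereal_inf [set t%:E | t in [set t : R | 0 < t /\ D (X t omega)]].

End Process.

Definition kato_class (R : realType) (n : nat)
    (p : R -> 'rV[R]_n -> 'rV[R]_n -> R)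
    (w : {measure set 'rV[R]_n -> \bar R}) : Prop :=
  ereal_sup (range (fun x : 'rV[R]_n =>
    \int[lebesgue_measure]_(s in `]0%R, t[) \int[w]_y (p s x y)%:E))%E
  @[t --> (0 : R)^'+] --> 0%E.

(* Main.v *)
(* Let K be a compact subset of D of small diameter with positive finite varpi-mass.
   Discretise the occupation functional of varpi restricted to K: on a time grid of
   step h, and in space at scale r ~ 1 / rho_eps, give the time t_i the mass
     nu_i = h rho_eps^n sum_l varpi(C_l) 1{|X_(t_i) - c_l| < r},
   where the cells C_l partition K and have centres c_l in K.
   By the lower bound on p and Chapman-Kolmogorov, rho_eps^n P^y(|X_s - z| < r) is
   at most a constant times p_(s+u)(y, z) for u in [eps, eps + h], so expected masses
   over short time windows are bounded by the Kato modulus of varpi, uniformly in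
   the starting point; by the Markov property so are the second moments, even of
   the mass close to the diagonal.  The expected total mass is bounded below
   by the lower bound on p.  Hence with probability bounded below the total mass
   is not small while every short interval carries little mass, and this happens at
   infinitely many scales with positive probability.  On that event the path must
   visit K: a right-continuous path avoiding K stays away from K for a while after
   every time, so a mass that cannot concentrate at single times would vanish in
   the limit. *)
Require Import Defs.
From mathcomp Require Import all_boot all_order all_algebra.
From mathcomp Require Import all_classical all_reals all_analysis.
From mathcomp Require Import measurable_realfun.
From mathcomp Require Import ring lra.

Set Implicit Arguments.
Unset Strict Implicit.
Unset Printing Implicit Defensive.

Import Order.TTheory GRing.Theory Num.Theory.
Import numFieldNormedType.Exports.

Local Open Scope classical_set_scope.
Local Open Scope ring_scope.

(** * Diffuse masses on the time axis *)

(** The integral of a nonnegative function is a supremum over the simple functions below it, which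
    is monotone without any measurability. The time integrand of the Kato condition is not known to
    be measurable. *)
Lemma ge0_le_integral_nonmeasurable d (T : measurableType d) (R : realType)
    (mu : {measure set T -> \bar R}) (D : set T) (f g : T -> \bar R) :
  (forall x, D x -> 0 <= f x)%E -> (forall x, D x -> f x <= g x)%E ->
  (\int[mu]_(x in D) f x <= \int[mu]_(x in D) g x)%E.
Proof.
move=> f0 fg; have g0 x : D x -> (0 <= g x)%E.
  by move=> Dx; rewrite (le_trans (f0 x Dx))// fg.
rewrite ge0_integralE// ge0_integralE//; apply: ge_ereal_sup.
move=> _ [h hf <-]; apply: ereal_sup_ubound; exists h => // x; apply: (le_trans (hf x)).
exact: lee_restrict.
Qed.

(* Induction along the time line: if [f] avoided [K], the mass before [s] would
   vanish in the limit for every [s]. This passes to suprema because short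
   intervals carry little mass, and beyond [s] because [f] stays away from the
   closed set [K] on some [s, s + q). Left limits of [f] play no role. *)
Lemma hit_of_diffuse_masses (R : realType) (V : normedModType R) (f : R -> V)
    (K : set V) (ta tb : R) (t : nat -> nat -> R) (N : nat -> nat)
    (nu : nat -> nat -> R) (r : nat -> R) (c : R) (G : nat -> Prop) :
  ta <= tb ->
  (forall s, ta <= s -> f x @[x --> s^'+] --> f s) ->
  closed K ->
  (forall e, 0 < e -> exists m, forall k, (m <= k)%N -> r k <= e) ->
  (forall k i, (i < N k)%N -> ta <= t k i <= tb) ->
  (forall k i, 0 <= nu k i) ->
  (forall k i, 0 < nu k i -> exists2 z, K z & `|f (t k i) - z| < r k) ->
  0 < c ->
  (forall m, exists2 k, (m <= k)%N & G k) ->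
  (forall k, G k -> c < \sum_(i < N k) nu k i) ->
  (forall e, 0 < e -> exists2 th, 0 < th & exists m, forall k, (m <= k)%N ->
    G k -> forall u v, v - u <= th ->
    \sum_(i < N k | u < t k i <= v) nu k i <= e) ->
  exists2 s, ta <= s <= tb & K (f s).
Proof.
move=> tab rcf cK r0 tN nu0 nuK c0 Ginf Gc Gth.
apply: contrapT => nohit.
have nK s : ta <= s <= tb -> ~ K (f s) by move=> hs Ks; apply: nohit; exists s.
pose Phi s := forall e, 0 < e -> exists m, forall k, (m <= k)%N -> G k ->
  \sum_(i < N k | t k i <= s) nu k i <= e.
have Phi_ta s : s < ta -> Phi s.
  move=> sta e e0; exists 0%N => k _ _; rewrite big1 ?ltW// => i tis.
  by have /andP[] := tN _ _ (ltn_ord i); lra.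
pose S := [set s | s <= tb /\ Phi s].
have S0 : S !=set0 by exists (ta - 1); split; [lra|apply: Phi_ta; lra].
have Stb : ubound S tb by move=> s [].
have hS : has_sup S by split => //; exists tb.
pose s1 := sup S.
have s1tb : s1 <= tb by apply: ge_sup.
have split_sum u v k : u <= v -> \sum_(i < N k | t k i <= v) nu k i =
    \sum_(i < N k | t k i <= u) nu k i +
    \sum_(i < N k | u < t k i <= v) nu k i.
  move=> uv; rewrite (bigID (fun i : 'I_(N k) => t k i <= u))/=; congr (_ + _).
    by apply: eq_bigl => i; apply/andP/idP => [[]//|tu]; split => //; lra.
  by apply: eq_bigl => i; rewrite -ltNge andbC.
(* Choose [s'] in [S] within [th] of the supremum: the mass up to [s'] and the mass in the short
   interval between [s'] and [s1] are each at most [e / 2]. *)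
have Phis1 : Phi s1.
  move=> e e0; have e20 : 0 < e / 2 by lra.
  have [th th0 [m1 hm1]] := Gth _ e20.
  have [s' [s'tb Phis'] s's1] := sup_adherent th0 hS.
  have s's : s' <= s1 by apply: ub_le_sup => //; exists tb.
  have [m2 hm2] := Phis' _ e20.
  exists (maxn m1 m2) => k; rewrite geq_max => /andP[k1 k2] Gk.
  rewrite (split_sum _ _ _ s's) [leRHS]splitr lerD ?hm2//.
  by apply: hm1 => //; rewrite -/s1 in s's1; lra.
(* If the supremum is [tb], the total mass vanishes in the limit, against the lower bound [c] at
   infinitely many indices. *)
have [s1lt|s1ge] := ltP s1 tb; last first.
  have {s1ge s1tb} s1E : s1 = tb by apply/eqP; rewrite eq_le s1tb s1ge.
  have [m hm] := Phis1 _ c0; have [k mk Gk] := Ginf m.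
  have := hm k mk Gk; rewrite s1E leNgt => /negP; apply.
  rewrite (eq_bigl xpredT) ?Gc// => i.
  by have /andP[] := tN _ _ (ltn_ord i).
have [s1ta|s1ta] := ltP s1 ta.
  have : S ((s1 + ta) / 2) by split; [lra|apply: Phi_ta; lra].
  move=> /(ub_le_sup (ex_intro _ _ Stb)); rewrite -/s1; lra.
have /nbhs_ballP[d /= d0 dK] : nbhs (f s1) (~` K).
  by apply: open_nbhs_nbhs; split; [exact: closed_openC|apply: nK; lra].
have d20 : 0 < d / 2 by lra.
have := rcf _ s1ta (ball (f s1) (d / 2)).
move=> /(_ (nbhsx_ballx _ _ d20)) [q /= q0 hq].
have {}hq t' : s1 < t' -> t' < s1 + q -> `|f s1 - f t'| < d / 2.
  move=> h1 h2; have := hq t'; rewrite /ball_ /= => /(_ _ h1).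
  rewrite -ball_normE/=; apply.
  by rewrite ltr0_norm; lra.
have [m' hm'] := r0 _ d20.
(* The cap at [tb] keeps [q'] a candidate for [S]; half of [q] keeps it strictly inside the interval
   where [f] stays [d / 2]-close to [f s1]. *)
pose q' := Num.min (s1 + q / 2) tb.
have q'tb : q' <= tb by rewrite /q' ge_min lexx orbT.
have q'q : q' <= s1 + q / 2 by rewrite /q' ge_min lexx.
have s1q' : s1 < q' by rewrite /q' lt_min s1lt andbT; lra.
have : S q'.
  split => // e e0; have [m hm] := Phis1 _ e0.
  exists (maxn m m') => k; rewrite geq_max => /andP[k1 k2] Gk.
  (* A positive mass at a time in this interval would put a point of [K] within [d / 2 + d / 2] of
     [f s1], so all these masses are zero. *)
  rewrite (split_sum _ _ _ (ltW s1q')) [X in _ + X]big1 ?addr0 ?hm//.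
  move=> i /andP[ti1 ti2]; apply/eqP; rewrite eq_le nu0 andbT leNgt.
  apply/negP => /nuK[z Kz fz]; apply: (dK z) => //; rewrite -ball_normE/=.
  have := hq _ ti1; have := hm' _ k2; move=> rk /(_ _) h.
  rewrite (le_lt_trans (ler_distD (f (t k i)) _ _))//.
  have : `|f s1 - f (t k i)| < d / 2 by apply: h; lra.
  lra.
move=> /(ub_le_sup (ex_intro _ _ Stb)); rewrite -/s1; lra.
Qed.

(* Cut [e, 2e] into M equal pieces with rho e / rho (2e) < 2 ^ M: on some piece
   [rho] decreases by a factor at most 2. *)
Lemma nonincreasing_comparable_scale (R : realType) (rho : R -> R) :
  (forall t, 0 < t <= 1 -> 0 < rho t) ->
  (forall s t, 0 < s -> s <= t -> t <= 1 -> rho t <= rho s) ->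
  forall eta, 0 < eta -> exists e h, [/\ 0 < e, 0 < h, e + h < eta,
    e + h <= 1 & rho e <= 2 * rho (e + h)].
Proof.
move=> rho0 rhod eta eta0.
(* This makes [2 * e] smaller than both [eta] and [1]. *)
pose e := Num.min (eta / 4) (1 / 4).
have e0 : 0 < e by rewrite /e lt_min; lra.
have e1 : e <= eta / 4 by rewrite /e ge_min lexx.
have e2 : e <= 1 / 4 by rewrite /e ge_min lexx orbT.
have re : 0 < rho e by apply: rho0; lra.
have r2e : 0 < rho (2 * e) by apply: rho0; lra.
have [M HM] : exists M : nat, rho e / rho (2 * e) < 2 ^+ M.
  exists (Num.truncn (rho e / rho (2 * e))).+1.
  rewrite (@lt_trans _ _ (Num.truncn (rho e / rho (2 * e))).+1%:R) ?truncnS_gt//.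
  by rewrite -natrX ltr_nat ltn_expl.
have M0 : (0 < M)%N.
  rewrite lt0n; apply/eqP => M0; move: HM.
  rewrite M0 expr0 ltr_pdivrMr// mul1r ltNge => /negP; apply.
  by apply: rhod; lra.
pose h := e / M%:R.
have MR : 0 < M%:R :> R by rewrite ltr0n.
have h0 : 0 < h by rewrite divr_gt0.
have hM : M%:R * h = e by rewrite /h mulrCA divff ?mulr1// gt_eqF.
have lek k : (k <= M)%N -> k%:R * h <= e.
  by move=> kM; rewrite -hM ler_pM2r// ler_nat.
apply: contrapT => nex.
(* If every piece failed, [rho] would more than halve on each of them, and [M] halvings contradict
   the choice of [M]. *)
have step k : (k <= M)%N -> 2 ^+ k * rho (e + k%:R * h) <= rho e.
  elim: k => [|k IH] kM; first by rewrite mul0r addr0 expr0 mul1r.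
  apply: le_trans (IH (ltnW kM)).
  rewrite exprSr -mulrA ler_pM2l ?exprn_gt0//.
  rewrite leNgt; apply/negP => lt2; apply: nex.
  have := lek _ kM; rewrite -natr1 mulrDl mul1r => kh.
  have kh0 : 0 <= k%:R * h by rewrite mulr_ge0// ltW.
  exists (e + k%:R * h), h; split => //; [lra|lra|lra|].
  have -> : e + k%:R * h + h = e + k.+1%:R * h.
    by rewrite -[k.+1%:R]natr1 mulrDl mul1r addrA.
  exact: ltW.
have := step M (leqnn _); rewrite hM -mulr2n -[e *+ 2]mulr_natl.
by rewrite leNgt -ltr_pdivrMr// HM.
Qed.

(** * Regularity of finite Borel measures *)

Lemma cvge_near_lt (R : realType) (u : (\bar R)^nat) (l x : \bar R) :
  u @ \oo --> l -> (l < x)%E ->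
  exists m, forall k, (m <= k)%N -> (u k < x)%E.
Proof.
move=> ul lx; have [|m _ hm] := ul [set y | (y < x)%E].
  by apply: open_nbhs_nbhs; split => //; exact: open_ereal_lt_ereal.
by exists m => k mk; exact: hm.
Qed.

Section closed_regularity.
Context (R : realType) (n : nat).
Implicit Types (A B F G U : set 'rV[R]_n).

Lemma open_measurable_rV U : open U -> measurable U.
Proof. exact: sub_sigma_algebra. Qed.

Lemma closed_measurable_rV F : closed F -> measurable F.
Proof.
by move=> cF; rewrite -[F]setCK; apply: measurableC; apply: open_measurable_rV;
  exact: closed_openC.
Qed.

Variable mu : {finite_measure set 'rV[R]_n -> \bar R}.

Let regular B := forall e : R, 0 < e -> exists F G,
  [/\ closed F, open G, F `<=` B, B `<=` G & (mu (G `\` F) < e%:E)%E].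

Let finite_lt (A : set 'rV[R]_n) : measurable A -> (mu A < +oo)%E.
Proof. by move=> mA; rewrite ltey_eq fin_num_measure. Qed.

Let regular_open U : open U -> regular U.
Proof.
move=> oU e e0.
(* The points at distance at least [1 / (k + 1)] from the complement of [U]; these closed sets
   increase to [U]. *)
pose F (k : nat) := ~` \bigcup_(y in ~` U) ball y (k.+1%:R^-1).
have oF k : open (\bigcup_(y in ~` U) ball y (k.+1%:R^-1)).
  by apply: bigcup_open => y _; exact: ball_open.
have cF k : closed (F k) by exact: open_closedC.
have FU k : F k `<=` U.
  move=> x; apply: contra_notP => Ux; exists x => //.
  by apply: ballxx; rewrite invr_gt0.
have UF : \bigcap_k (U `\` F k) = set0.
  rewrite -subset0 => x xF.
  have Ux : U x by have [] := xF 0%N I.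
  have /nbhs_ballP[d /= d0 dU] : nbhs x U by exact: open_nbhs_nbhs.
  have [k kd] : exists k : nat, k.+1%:R^-1 < d.
    exists (Num.truncn d^-1); rewrite invf_plt ?posrE ?truncnS_gt//.
  have [_ /contrapT[y Uy xy]] := xF k I.
  by apply: Uy; apply: dU; apply: ball_sym; apply: le_ball xy; exact: ltW.
have mUF k : measurable (U `\` F k).
  by apply: measurableD; [exact: open_measurable_rV|exact: closed_measurable_rV].
have : mu (U `\` F k) @[k --> \oo] --> mu (\bigcap_k (U `\` F k)).
  apply: nonincreasing_cvg_mu => //.
  - exact: finite_lt.
  - exact: bigcapT_measurable.
  - move=> i j ij; apply/subsetPset => x [Ux Fx]; split => // Fix; apply: Fx.
    move=> [y Uy xy]; apply: Fix; exists y => //; apply: le_ball xy.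
    by rewrite lef_pV2 ?posrE// ler_nat.
rewrite UF measure0 => /cvge_near_lt /(_ (_ : (0 < e%:E)%E)).
rewrite lte_fin => /(_ e0) [k /(_ k (leqnn _)) /= ke].
by exists (F k), U; split => //; exact: FU.
Qed.

Let regularC B : regular B -> regular (~` B).
Proof.
move=> rB e e0; have [F [G [cF oG FB BG FGe]]] := rB e e0.
exists (~` G), (~` F); split; [exact: open_closedC|exact: closed_openC| | |].
- exact: subsetC.
- exact: subsetC.
- by rewrite setDE setCK setIC -setDE.
Qed.

Let regular_bigcup (B : (set 'rV[R]_n)^nat) :
  (forall i, regular (B i)) -> regular (\bigcup_i B i).
Proof.
move=> rB e e0; have e20 : 0 < e / 2 by rewrite divr_gt0.
have /choice[FG hFG] i : exists FG : set 'rV[R]_n * set 'rV[R]_n,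
    [/\ closed FG.1, open FG.2, FG.1 `<=` B i, B i `<=` FG.2 &
    (mu (FG.2 `\` FG.1) < (e / 2 / (2 ^ i.+1)%:R)%:E)%E].
  have [|F [G FG]] := rB i (e / 2 / (2 ^ i.+1)%:R).
    by rewrite divr_gt0// ltr0n expn_gt0.
  by exists (F, G).
pose G := \bigcup_i (FG i).2.
have oG : open G by apply: bigcup_open => i _; have [] := hFG i.
pose F m := \big[setU/set0]_(i < m) (FG i).1.
have cF m : closed (F m).
  by apply: closed_bigsetU => i _; have [] := hFG i.
have mGF m : measurable (G `\` F m).
  by apply: measurableD; [exact: open_measurable_rV|exact: closed_measurable_rV].
(* An infinite union of closed sets need not be closed, so finite unions are taken and continuity
   from above provides a good [m]. The errors sum to at most [e / 2], which leaves room for the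
   strict bound. *)
have cvgGF : mu (G `\` F m) @[m --> \oo] --> mu (\bigcap_m (G `\` F m)).
  apply: nonincreasing_cvg_mu => //.
  - exact: finite_lt.
  - exact: bigcapT_measurable.
  - move=> i j ij; apply/subsetPset => x [Gx Fx]; split => // Fix; apply: Fx.
    exact: (subset_bigsetU (F := fun i => (FG i).1) ij).
have mFG i : measurable ((FG i).2 `\` (FG i).1).
  have [? ? _ _ _] := hFG i.
  by apply: measurableD; [exact: open_measurable_rV|exact: closed_measurable_rV].
have lime : (mu (\bigcap_m (G `\` F m)) < e%:E)%E.
  apply: (@le_lt_trans _ _ (e / 2)%:E); last by rewrite lte_fin; lra.
  apply: (@le_trans _ _ (\sum_(i <oo) mu ((FG i).2 `\` (FG i).1))%E).
    apply: measure_sigma_subadditive => //; first exact: bigcapT_measurable.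
    move=> x xGF; have [[i _ Gx] _] := xGF 0%N I; exists i => //; split => // Fx.
    have [_] := xGF i.+1 I; apply; rewrite /F -(bigcup_mkord _ (fun i => (FG i).1)).
    by exists i => /=.
  apply: le_trans (epsilon_trick0 xpredT (ltW e20)).
  apply: lee_nneseries => // i _.
  by have [_ _ _ _ /ltW] := hFG i.
have [m /(_ m (leqnn _)) /= me] := cvge_near_lt cvgGF lime.
exists (F m), G; split => //.
- rewrite /F -(bigcup_mkord _ (fun i => (FG i).1)) => x [i _ Fx]; exists i => //.
  by have [_ _ + _ _] := hFG i; exact.
- by apply: subset_bigcup => i _; have [_ _ _ + _] := hFG i.
Qed.

(** The sets with this approximation property form a sigma-algebra containing the open sets. *)
Lemma measurable_closed_open_approx B : measurable B ->
  forall e : R, 0 < e -> exists F G,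
  [/\ closed F, open G, F `<=` B, B `<=` G & (mu (G `\` F) < e%:E)%E].
Proof.
move=> mB; suff : measurable `<=` regular by exact.
apply: smallest_sub => //; split.
- by apply: regular_open; exact: open0.
- by move=> A rA; rewrite setTD; exact: regularC.
- exact: regular_bigcup.
Qed.

End closed_regularity.

(** The restriction of [w] to [B] is a finite measure; approximating [B] with an error below [w B]
    leaves positive mass on the closed set. *)
Lemma closed_subset_pos_measure (R : realType) (n : nat)
    (w : {measure set 'rV[R]_n -> \bar R}) (B : set 'rV[R]_n) :
  measurable B -> (0 < w B < +oo)%E ->
  exists K, [/\ closed K, K `<=` B & (0 < w K)%E].
Proof.
move=> mB /andP[wB0 wBoo].
have wBfin : w B \is a fin_num by rewrite ge0_fin_numE ?measure_ge0.
have wB1 : 0 < fine (w B) by rewrite fine_gt0// wB0.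
have [F [G [cF oG FB BG]]] := measurable_closed_open_approx
  (mfrestr mB wBoo : {finite_measure set _ -> \bar R}) mB wB1.
rewrite fineK//= /mfrestr /mrestr => GFw.
exists F; split => //; rewrite lt0e measure_ge0 andbT; apply/eqP => wF0.
have mF := closed_measurable_rV cF.
have mG := open_measurable_rV oG.
move: GFw; apply/negP; rewrite -leNgt.
rewrite (@le_trans _ _ (w (F `|` (G `\` F) `&` B)))//.
  apply: le_measure; rewrite ?inE//.
  - by apply: measurableU => //; apply: measurableI => //; exact: measurableD.
  - move=> x Bx; have [Fx|Fx] := pselect (F x); [by left|right].
    by split => //; split => //; exact: BG.
rewrite (le_trans (measureU2 _ _ _))//.
  by apply: measurableI => //; exact: measurableD.
by rewrite [X in (X + _)%E]wF0 add0e.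
Qed.

(** * Norms and the scale function *)

Section sup_norm.
Context (R : realType) (n : nat).
Implicit Types (x y z : 'rV[R]_n) (r : R).

Lemma normr_coord z i : `|z 0 i| <= `|z|.
Proof.
have /mapP[j Hj ->] : `|z 0 i| \in [seq `|z x.1 x.2| | x : 'I_1 * 'I_n].
  by apply/mapP; exists (0, i) => //=; rewrite mem_enum.
by rewrite [leRHS]/Num.norm /= mx_normrE; apply/bigmax_geP; right => /=; exists j.
Qed.

Lemma normr_rV_le z r : 0 <= r -> (forall i, `|z 0 i| <= r) -> `|z| <= r.
Proof.
move=> r0 zr; rewrite [leLHS]/Num.norm /= mx_normrE; apply/bigmax_leP; split => //.
by move=> [i j] _ /=; rewrite ord1.
Qed.

Lemma dot_self_ge0 z : 0 <= dot z z.
Proof. by apply: sumr_ge0 => i _; rewrite -expr2 sqr_ge0. Qed.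

Lemma enorm_sqr z : enorm z ^+ 2 = dot z z.
Proof. by rewrite /enorm sqr_sqrtr// dot_self_ge0. Qed.

Lemma enorm_coord z i : `|z 0 i| <= enorm z.
Proof.
rewrite -(@ler_pXn2r _ 2)// ?nnegrE ?sqrtr_ge0// enorm_sqr real_normK ?num_real//.
rewrite /dot (bigD1 i)//= expr2 lerDl sumr_ge0// => j _.
by rewrite -expr2 sqr_ge0.
Qed.

Lemma enorm_le z : enorm z <= n%:R * `|z|.
Proof.
rewrite -(@ler_pXn2r _ 2)// ?nnegrE ?sqrtr_ge0 ?mulr_ge0// enorm_sqr.
apply: (@le_trans _ _ (\sum_(i < n) `|z| ^+ 2)).
  apply: ler_sum => i _; rewrite -expr2 -real_normK ?num_real//.
  by rewrite ler_pXn2r ?nnegrE// normr_coord.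
rewrite sumr_const card_ord -[leLHS]mulr_natl [leRHS]exprMn.
apply: ler_wpM2r; first exact: sqr_ge0.
by rewrite -natrX ler_nat; case: (n) => // k; rewrite leq_pmulr.
Qed.

Lemma dot_le x y : `|dot x y| <= n%:R * (enorm x * enorm y).
Proof.
rewrite (le_trans (ler_norm_sum _ _ _))//.
apply: (@le_trans _ _ (\sum_(i < n) enorm x * enorm y)).
  by apply: ler_sum => i _; rewrite normrM ler_pM// enorm_coord.
by rewrite sumr_const card_ord mulr_natl.
Qed.

Lemma continuous_measurable_rV (f : 'rV[R]_n -> R) :
  continuous f -> measurable_fun setT f.
Proof.
move=> /continuousP cf; apply: (measurability _ (RGenOpens.measurableE R)).
move=> _ [_ [a [b ->] <-]]; rewrite setTI; apply: open_measurable_rV.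
exact/cf/interval_open.
Qed.

Lemma measurable_coord i : measurable_fun setT (fun y : 'rV[R]_n => y 0 i).
Proof.
by apply: continuous_measurable_rV => y; exact: coord_continuous.
Qed.

Lemma measurable_enorm_sqr : measurable_fun setT (fun z => enorm z ^+ 2).
Proof.
under eq_fun do rewrite enorm_sqr /dot.
by apply: measurable_sum => i; apply: measurable_funM; exact: measurable_coord.
Qed.

(** Half-open, to have the form of the cells on which [is_lebesgue] prescribes the measure; up to
    its boundary it is a ball of the sup norm. *)
Definition box z r : set 'rV[R]_n :=
  [set y | forall i, z 0 i - r < y 0 i <= z 0 i + r].

Lemma measurable_box z r : measurable (box z r).
Proof.
have -> : box z r = \bigcap_(i in [set: 'I_n])
    (setT `&` (fun y : 'rV[R]_n => y 0 i) @^-1` `]z 0 i - r, z 0 i + r]).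
  apply/seteqP; split => y.
    by move=> yz i _; split => //=; rewrite in_itv/= yz.
  by move=> yz i; have [_ /=] := yz i I; rewrite in_itv.
apply: fin_bigcap_measurable => // i _.
exact: measurable_coord.
Qed.

Lemma box_norm z r y : box z r y -> 0 <= r -> `|z - y| <= r.
Proof.
move=> zy r0; apply: normr_rV_le => // i; have := zy i.
by rewrite !mxE ler_norml; lra.
Qed.

Lemma lebesgue_box leb z r : is_lebesgue leb -> 0 <= r ->
  leb (box z r) = ((2 * r) ^+ n)%:E.
Proof.
move=> lebP r0.
have -> : box z r = [set x : 'rV[R]_n | forall i,
    (z - const_mx r) 0 i < x 0 i <= (z + const_mx r) 0 i].
  by apply/seteqP; split => y /= yz i; have := yz i; rewrite !mxE.
etransitivity; first by apply: lebP => i; rewrite !mxE; lra.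
congr EFin; rewrite (eq_bigr (fun=> 2 * r)) ?prodr_const ?card_ord//.
by move=> i _; rewrite !mxE; lra.
Qed.

End sup_norm.

Section rho.
Context (R : realType) (n : nat) (mu : {measure set 'rV[R]_n -> \bar R}).
Hypothesis mu_levy : levy_measure mu.

Lemma qstar_le r s : 0 <= r -> r <= s -> (qstar mu r <= qstar mu s)%E.
Proof.
move=> r0 rs; apply: ge_ereal_sup => _ [l sl <-].
apply: le_trans; last by apply: ereal_sup_ubound; exists l => //.
apply: ge0_le_integral_nonmeasurable => h _.
  by rewrite lee_fin le_min sqr_ge0 ler01.
have dotZ t : dot (t *: l) h = t * dot l h.
  by rewrite /dot mulr_sumr; apply: eq_bigr => i _; rewrite !mxE mulrA.
rewrite lee_fin !dotZ !exprMn le_min !ge_min lexx orbT andbT; apply/orP; left.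
by rewrite ler_wpM2r ?sqr_ge0// ler_pXn2r ?nnegrE// (le_trans r0).
Qed.

(** The integrand of [qU] is at most a constant times [Num.min 1 (enorm h ^+ 2)], uniformly over the
    sphere, and the latter is integrable for a Lévy measure. *)
Lemma qstar_fin r : (qstar mu r < +oo)%E.
Proof.
have [_ levyoo] := mu_levy.
pose c := Num.max 1 ((r * n%:R) ^+ 2).
apply: (@le_lt_trans _ _ (c%:E *
    \int[mu]_(h in punctured) (Num.min 1 (enorm h ^+ 2))%:E)%E); last first.
  rewrite lte_mul_pinfty// lee_fin.
  by rewrite /c le_max ler01.
have c0 : 0 <= c by rewrite /c le_max ler01.
have mpunct : measurable (@punctured R n).
  apply: measurableC; apply: closed_measurable_rV.
  exact/accessible_closed_set1/hausdorff_accessible/norm_hausdorff.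
apply: ge_ereal_sup => _ [l sl <-].
rewrite -ge0_integralZl_EFin//; last first.
- apply/measurable_EFinP; apply: measurable_funTS.
  apply: (@measurable_minr _ _ _ _ (cst 1) (fun x => enorm x ^+ 2)) => //.
  exact: measurable_enorm_sqr.
- by move=> h _; rewrite lee_fin le_min sqr_ge0 ler01.
apply: ge0_le_integral_nonmeasurable => h _.
  by rewrite lee_fin le_min sqr_ge0 ler01.
rewrite -EFinM lee_fin.
have e1 : 0 <= enorm h ^+ 2 by exact: sqr_ge0.
have d1 : dot (r *: l) h ^+ 2 <= c * enorm h ^+ 2.
  apply: (@le_trans _ _ ((r * n%:R) ^+ 2 * enorm h ^+ 2)); last first.
    by rewrite ler_wpM2r// /c le_max lexx orbT.
  have -> : dot (r *: l) h = r * dot l h.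
    by rewrite /dot mulr_sumr; apply: eq_bigr => i _; rewrite !mxE mulrA.
  rewrite (exprMn 2 r (dot l h)) (exprMn 2 r) -[leRHS]mulrA.
  apply: ler_wpM2l; first exact: sqr_ge0.
  rewrite -[leRHS]exprMn -[leLHS]real_normK ?num_real// ler_pXn2r ?nnegrE ?mulr_ge0 ?sqrtr_ge0//.
  by have := dot_le l h; rewrite sl mul1r.
have [h1|h1] := leP 1 (enorm h ^+ 2).
  by rewrite mulr1 ge_min; apply/orP; right; rewrite /c le_max lexx.
by rewrite ge_min d1.
Qed.

Let rho_set t := [set r | 0 < r /\ ((t^-1)%:E <= qstar mu r)%E].

Lemma rho_ge0 t : 0 <= rho mu t.
Proof.
have [/eqP S0|/set0P S0] := boolP (rho_set t == set0).
  by rewrite /rho -/(rho_set t) S0 inf0.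
by apply: lb_le_inf => // r [/ltW].
Qed.

(** The infimum of the empty set is [0] by convention, so positivity of [rho] certifies that it is a
    genuine infimum. *)
Lemma rho_set_nonempty t : 0 < rho mu t -> rho_set t !=set0.
Proof.
move=> t0; apply/set0P/eqP => S0.
by move: t0; rewrite /rho -/(rho_set t) S0 inf0 ltxx.
Qed.

Lemma rho_nonincreasing s t : 0 < s -> s <= t -> 0 < rho mu s ->
  rho mu t <= rho mu s.
Proof.
move=> s0 st rs; apply: lb_le_inf; first exact: rho_set_nonempty.
move=> r [r0 rq]; apply: ge_inf; first by exists 0 => ? [/ltW].
split => //; apply: le_trans rq.
by rewrite lee_fin lef_pV2 ?posrE// (lt_le_trans s0).
Qed.

(** A radius [r < M] with [1 / t <= qstar r] forces [1 / t <= qstar M], which is finite; this fails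
    for small [t]. *)
Lemma rho_pinfty (M : R) : 0 < M -> exists2 t0, 0 < t0 & forall t, 0 < t ->
  t < t0 -> 0 < rho mu t -> M <= rho mu t.
Proof.
move=> M0; pose q := fine (qstar mu M).
(* An inequality only: over an empty sphere the supremum is [-oo]. *)
have qE : (qstar mu M <= `|q|%:E)%E.
  rewrite /q; case: (qstar mu M) (qstar_fin M) => [x _||_].
  - by rewrite lee_fin ler_norm.
  - by rewrite ltxx.
  - by rewrite leNye.
exists (`|q| + 1)^-1; first by rewrite invr_gt0 ltr_wpDl.
move=> t t0 tq rt; apply: lb_le_inf; first exact: rho_set_nonempty.
move=> r [r0 rq]; rewrite leNgt; apply/negP => rM.
have := le_trans (le_trans rq (qstar_le (ltW r0) (ltW rM))) qE.
rewrite lee_fin leNgt => /negP; apply.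
have : `|q| + 1 < t^-1.
  by rewrite -ltf_pV2 ?posrE ?invr_gt0 ?ltr_wpDl// invrK.
lra.
Qed.

End rho.

(** * Pointwise consequences of the density bounds *)

Lemma transition_density_continuous (R : realType) (n : nat)
    (d : measure_display) (Omega : measurableType d)
    (P : 'rV[R]_n -> probability Omega R) (X : R -> Omega -> 'rV[R]_n)
    (leb : {measure set 'rV[R]_n -> \bar R})
    (p : R -> 'rV[R]_n -> 'rV[R]_n -> R) :
  transition_density P X leb p ->
  forall t x, 0 < t -> continuous (p t x).
Proof.
move=> [_ pcont] t x t0 y.
have /subspace_continuousP/(_ (t, x, y) (lexx t)) pc := pcont t t0.
move=> S /pc [[U1 U2] /= [hU1 hU2] hU].
apply: filterS hU2 => y' U2y'; apply: (hU (t, x, y')) => //=.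
by split => //=; exact: nbhs_singleton.
Qed.

Section process.
Context (R : realType) (n : nat) (leb : {measure set 'rV[R]_n -> \bar R}).
Context (d : measure_display) (Omega : measurableType d).
Variables (P : 'rV[R]_n -> probability Omega R) (X : R -> Omega -> 'rV[R]_n).
Variables (p : R -> 'rV[R]_n -> 'rV[R]_n -> R).
Hypothesis lebP : is_lebesgue leb.
Hypothesis markov : markov_process P X.
Hypothesis density : transition_density P X leb p.
Variables (A C : R) (rho : R -> R).
Hypotheses (A0 : 0 < A) (C0 : 0 < C).
Hypothesis rho_gt0 : forall t, 0 < t <= 1 -> 0 < rho t.
Hypothesis p_ge0 : forall t x y, 0 < t <= 1 -> 0 <= p t x y.
Hypothesis p_low : forall t x y, 0 < t <= 1 -> `|y - x| <= C / rho t ->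
  A * rho t ^+ n <= p t x y.

Lemma measurable_preimage_process t (B : set 'rV[R]_n) : 0 <= t -> measurable B ->
  measurable (X t @^-1` B).
Proof.
by move=> t0 mB; have [mX _ _ _] := markov; rewrite -[_ @^-1` _]setTI; exact: mX.
Qed.

Lemma measurable_ball_rV (z : 'rV[R]_n) r : measurable (ball z r).
Proof.
have [r0|r0] := ltP 0 r; first by apply: open_measurable_rV; exact: ball_open.
rewrite (_ : ball z r = set0)// -subset0 => y.
by rewrite mx_norm_ball /ball_/= ltNge (le_trans r0).
Qed.

Lemma prob_box_ge t x z r : 0 < t <= 1 -> 0 < r ->
  (forall y, `|z - y| <= r -> `|y - x| <= C / rho t) ->
  ((A * rho t ^+ n * (2 * r) ^+ n)%:E <= P x (X t @^-1` box z r))%E.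
Proof.
move=> t01 r0 zr; have /andP[t0 _] := t01.
rewrite (density.1 _ _ _ t0); last exact: measurable_box.
rewrite EFinM -(lebesgue_box z lebP (ltW r0)) -integral_cst; last first.
  exact: measurable_box.
apply: ge0_le_integral_nonmeasurable => y yz /=; rewrite lee_fin.
  by rewrite mulr_ge0 ?exprn_ge0 ?(ltW A0)// ltW// rho_gt0.
by apply: p_low => //; apply: zr; apply: box_norm => //; exact: ltW.
Qed.

Lemma prob_box_le t x z e : 0 < t <= 1 -> 0 < e ->
  exists2 r0, 0 < r0 & forall r, 0 < r -> r < r0 ->
  (P x (X t @^-1` box z r) <= ((p t x z + e) * (2 * r) ^+ n)%:E)%E.
Proof.
move=> t01 e0; have /andP[t0 _] := t01.
have pc : p t x y @[y --> z] --> p t x z.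
  exact: (transition_density_continuous density t0).
have /nbhs_ballP[r0 /= r00 hr0] : \forall y \near z, `|p t x z - p t x y| < e.
  by move/cvgrPdist_lt : pc; exact.
exists r0 => // r r_gt0 rr0.
rewrite (density.1 _ _ _ t0); last exact: measurable_box.
rewrite EFinM -(lebesgue_box z lebP (ltW r_gt0)) -integral_cst; last first.
  exact: measurable_box.
apply: ge0_le_integral_nonmeasurable => y yz /=; rewrite lee_fin.
  exact: p_ge0.
have := hr0 y; rewrite mx_norm_ball /ball_/= => /(_ _).
have := box_norm yz (ltW r_gt0) => zy /(_ (le_lt_trans zy rr0)).
by rewrite ltr_norml; lra.
Qed.

Lemma markov_setT y s u B : 0 <= s -> 0 <= u -> measurable B ->
  P y (X (s + u) @^-1` B) = (\int[P y]_omega P (X s omega) (X u @^-1` B))%E.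
Proof.
move=> s0 u0 mB; have [_ _ _ /(_ y s u setT B s0 u0)] := markov.
rewrite setTI; apply => //.
apply: sub_sigma_algebra; exists 0, setT; split => //.
by rewrite lexx.
Qed.

Lemma measurable_transition s u (B : set 'rV[R]_n) (E : set Omega) :
  0 <= s -> 0 <= u -> measurable B ->
  measurable_fun E (fun omega => P (X s omega) (X u @^-1` B)).
Proof.
move=> s0 u0 mB; have [mX _ mP _] := markov; apply: measurable_funTS.
exact: (measurableT_comp (mP u B u0 mB) (mX s s0)).
Qed.

(** Chapman-Kolmogorov, keeping only the paths that are in [E] at time [s]. *)
Lemma markov_ge y s u (B E : set 'rV[R]_n) b : 0 <= s -> 0 <= u ->
  measurable B -> measurable E -> 0 <= b ->
  (forall w, E w -> (b%:E <= P w (X u @^-1` B))%E) ->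
  (b%:E * P y (X s @^-1` E) <= P y (X (s + u) @^-1` B))%E.
Proof.
move=> s0 u0 mB mE b0 bE; have mXE := measurable_preimage_process s0 mE.
rewrite markov_setT//.
apply: (@le_trans _ _ (\int[P y]_(omega in X s @^-1` E)
    P (X s omega) (X u @^-1` B))%E); last first.
  apply: ge0_subset_integral => //; first exact: measurable_transition.
rewrite -integral_cst//.
by apply: ge0_le_integral_nonmeasurable => // omega /bE.
Qed.

(* A Chapman-Kolmogorov inequality at every [z], not just almost every [z]: the
   measure integrated against [p] may be singular. Both sides are averaged over
   boxes shrinking to [z], where [p] is continuous. *)
Lemma prob_ball_le_density y s u c r z : 0 <= s -> 0 < u -> s + u <= 1 ->
  0 < r -> 3 * r <= C / rho u -> `|c - z| < r ->
  ((A * rho u ^+ n)%:E * P y (X s @^-1` ball c r) <= (p (s + u) y z)%:E)%E.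
Proof.
move=> s0 u0 su1 r0 rC cz.
have u01 : 0 < u <= 1 by apply/andP; split; lra.
have su01 : 0 < s + u <= 1 by apply/andP; split; lra.
have ru : 0 < rho u by exact: rho_gt0.
apply/lee_addgt0Pr => e e0; rewrite -EFinD.
have [r1 r10 hr1] := prob_box_le y z su01 e0.
(* The first bound keeps the box within [3 * r] of every point of the ball around [c]; the second
   makes the upper estimate [hr1] available. The common factor [(2 * r') ^+ n] cancels at the
   end. *)
pose r' := Num.min (r / 2) (r1 / 2).
have r'0 : 0 < r' by rewrite /r' lt_min; apply/andP; split; lra.
have r'r : r' <= r / 2 by rewrite /r' ge_min lexx.
have r'r1 : r' <= r1 / 2 by rewrite /r' ge_min lexx orbT.
have r'r1' : r' < r1 by lra.
move: (hr1 r' r'0 r'r1').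
have : forall w, ball c r w ->
    ((A * rho u ^+ n * (2 * r') ^+ n)%:E <= P w (X u @^-1` box z r'))%E.
  move=> w; rewrite mx_norm_ball /ball_/= => cw; apply: prob_box_ge => // y' zy'.
  apply: le_trans rC.
  rewrite (_ : y' - w = (y' - z) + ((z - c) + (c - w))); last first.
    by rewrite !addrA !subrK.
  have := ler_normD (y' - z) ((z - c) + (c - w)).
  have := ler_normD (z - c) (c - w).
  by rewrite (distrC y' z) (distrC z c); lra.
have b0 : 0 <= A * rho u ^+ n * (2 * r') ^+ n.
  by rewrite ltW// mulr_gt0 ?mulr_gt0// exprn_gt0// mulr_gt0.
move=> /(markov_ge y s0 (ltW u0) (measurable_box z r')
  (measurable_ball_rV c r) b0) h2 h1.
have := le_trans h2 h1.
have Pfin : P y (X s @^-1` ball c r) \is a fin_num.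
  by apply: fin_num_measure; apply: measurable_preimage_process => //;
    exact: measurable_ball_rV.
rewrite -(fineK Pfin) -!EFinM !lee_fin mulrAC ler_pM2r//.
by rewrite exprn_gt0// mulr_gt0.
Qed.

(** In one unit of time the density is bounded below up to distance [C / rho 1]. A jump of half that
    length leaves a quarter of it for the error at the start and a quarter for the error at the
    end. *)
Let step_reach x w w' (k : nat) : `|w' - w| <= C / rho 1 / 2 ->
  (forall r, 0 < r -> (0 < P x (X k%:R @^-1` ball w r))%E) ->
  forall r, 0 < r -> (0 < P x (X k.+1%:R @^-1` ball w' r))%E.
Proof.
move=> ww' hk r r0.
have t1 : 0 < (1 : R) <= 1 by rewrite ltr01 lexx.
have rho1 := rho_gt0 t1.
have D0 : 0 < C / rho 1 by rewrite divr_gt0.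
pose r' := Num.min (r / 2) (C / rho 1 / 4).
have r'0 : 0 < r' by rewrite /r' lt_min; apply/andP; split; lra.
have r'r : r' <= r / 2 by rewrite /r' ge_min lexx.
have r'D : r' <= C / rho 1 / 4 by rewrite /r' ge_min lexx orbT.
have b0 : 0 < A * rho 1 ^+ n * (2 * r') ^+ n.
  by rewrite mulr_gt0 ?mulr_gt0// exprn_gt0// mulr_gt0.
have hb : forall v, ball w r' v ->
    ((A * rho 1 ^+ n * (2 * r') ^+ n)%:E <= P v (X 1 @^-1` box w' r'))%E.
  move=> v; rewrite mx_norm_ball /ball_/= => wv; apply: prob_box_ge => // y wy.
  rewrite (_ : y - v = (y - w') + ((w' - w) + (w - v))); last first.
    by rewrite !addrA !subrK.
  have := ler_normD (y - w') ((w' - w) + (w - v)).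
  have := ler_normD (w' - w) (w - v).
  by rewrite (distrC y w'); lra.
have := markov_ge x (ler0n _ k) ler01 (measurable_box w' r')
  (measurable_ball_rV w r') (ltW b0) hb.
move=> h; rewrite -[k.+1%:R]natr1.
apply: (@lt_le_trans _ _ (P x (X (k%:R + 1) @^-1` box w' r'))).
  by apply: lt_le_trans h; rewrite mule_gt0// hk.
apply: le_measure; rewrite ?inE.
- by apply: measurable_preimage_process; [rewrite addr_ge0|exact: measurable_box].
- by apply: measurable_preimage_process; [rewrite addr_ge0|exact: measurable_ball_rV].
- move=> omega /= /box_norm/(_ (ltW r'0)) hw.
  by rewrite mx_norm_ball /ball_/=; lra.
Qed.

(** The segment from [x] to [z] is cut into [N] steps short enough for [step_reach], and the path
    follows small balls along it at integer times. *)
Lemma process_reaches_ball x z r : 0 < r ->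
  exists k : nat, (0 < P x (X k%:R @^-1` ball z r))%E.
Proof.
have t1 : 0 < (1 : R) <= 1 by rewrite ltr01 lexx.
have D0 : 0 < C / rho 1 / 2 by rewrite !divr_gt0// rho_gt0.
pose N := (Num.truncn (`|z - x| / (C / rho 1 / 2))).+1.
have N0 : 0 < N%:R :> R by rewrite ltr0n.
have NE : `|z - x| / N%:R <= C / rho 1 / 2.
  by rewrite ler_pdivrMr// -ler_pdivrMl// mulrC ltW// truncnS_gt.
have H (k : nat) : forall r, 0 < r ->
    (0 < P x (X k%:R @^-1` ball (x + (k%:R / N%:R) *: (z - x))%R r))%E.
  elim: k => [|k IH].
    move=> s s0; rewrite mul0r scale0r addr0.
    have [_ P0 _ _] := markov.
    apply: (@lt_le_trans _ _ (P x (X 0 @^-1` [set x]))); first by rewrite P0.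
    apply: le_measure; rewrite ?inE.
    - apply: measurable_preimage_process => //; apply: closed_measurable_rV.
      exact/accessible_closed_set1/hausdorff_accessible/norm_hausdorff.
    - by apply: measurable_preimage_process => //; exact: measurable_ball_rV.
    - by move=> omega /= ->; exact: ballxx.
  apply: step_reach IH.
  rewrite opprD addrACA subrr add0r -scalerBl -mulrBl -natr1 addrAC subrr add0r.
  rewrite mul1r normrZ ger0_norm; last by rewrite invr_ge0 ltW.
  by rewrite mulrC.
move=> r0; exists N; have := H N r r0.
by rewrite divff ?gt_eqF// scale1r addrC subrK.
Qed.

End process.

(** * Second moment of the occupation weights *)

Section occupation.
Context (R : realType) (n : nat) (d : measure_display) (Omega : measurableType d).
Variables (P : 'rV[R]_n -> probability Omega R) (X : R -> Omega -> 'rV[R]_n).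
Hypothesis markov : markov_process P X.
Variables (L : nat) (q : 'I_L -> R) (c : 'I_L -> 'rV[R]_n) (r : R).
Hypothesis q_ge0 : forall l, 0 <= q l.

(** When [q l] is the mass of a cell near [c l], this is the measure smoothed at scale [r], up to
    normalisation. *)
Definition weight (v : 'rV[R]_n) : R := \sum_(l < L) q l * \1_(ball (c l) r) v.

(* The expectation of [weight (X s)] for the process started at [y]. *)
Definition mean_weight (y : 'rV[R]_n) (s : R) : \bar R :=
  (\sum_(l < L) (q l)%:E * P y (X s @^-1` ball (c l) r))%E.

Lemma weight_ge0 v : 0 <= weight v.
Proof. by apply: sumr_ge0 => l _; rewrite mulr_ge0. Qed.

Lemma mean_weight_ge0 y s : (0 <= mean_weight y s)%E.
Proof. by apply: sume_ge0 => l _; rewrite mule_ge0// lee_fin. Qed.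

Lemma weight_gt0 v : 0 < weight v -> exists l, `|c l - v| < r.
Proof.
move=> v0; apply: contrapT => nl; move: v0; rewrite /weight big1 ?ltxx// => l _.
rewrite indicE memNset ?mulr0// mx_norm_ball /ball_/= => cv.
by apply: nl; exists l.
Qed.

Lemma measurable_weight s (E : set Omega) : 0 <= s ->
  measurable_fun E (fun omega => weight (X s omega)).
Proof.
move=> s0; apply: measurable_funTS; have [/(_ s s0) mX _ _ _] := markov.
apply: (measurableT_comp _ mX); apply: measurable_sum => l.
by apply: measurable_funM => //; apply: measurable_indic; exact: measurable_ball_rV.
Qed.

Let measurable_hit s l : 0 <= s -> measurable (X s @^-1` ball (c l) r).
Proof.
by move=> s0; apply: (measurable_preimage_process markov) => //;
  exact: measurable_ball_rV.
Qed.

Let measurable_hit_indic s l (E : set Omega) : 0 <= s ->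
  measurable_fun E (fun omega => \1_(ball (c l) r) (X s omega) : R).
Proof.
move=> s0; apply: measurable_funTS; have [/(_ s s0) mX _ _ _] := markov.
apply: (measurableT_comp _ mX); apply: measurable_indic.
exact: measurable_ball_rV.
Qed.

Lemma integral_weight y s (E : set Omega) : 0 <= s -> measurable E ->
  (\int[P y]_(omega in E) (weight (X s omega))%:E =
   \sum_(l < L) (q l)%:E * P y (E `&` X s @^-1` ball (c l) r))%E.
Proof.
move=> s0 mE; under eq_integral do rewrite /weight -sumEFin.
rewrite ge0_integral_sum//; last 2 first.
- move=> l; apply/measurable_EFinP; apply: measurable_funM => //.
  exact: measurable_hit_indic.
- by move=> l omega _; rewrite lee_fin mulr_ge0.
apply: eq_bigr => l _; under eq_integral do rewrite EFinM.
rewrite ge0_integralZl_EFin//; last first.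
  by apply/measurable_EFinP; exact: measurable_hit_indic.
by rewrite setIC -integral_indic//; exact: measurable_hit.
Qed.

Lemma integral_mul_weight y s (F : Omega -> R) : 0 <= s ->
  measurable_fun setT F -> (forall omega, 0 <= F omega) ->
  (\int[P y]_omega (weight (X s omega) * F omega)%:E =
   \sum_(l < L) (q l)%:E *
     \int[P y]_(omega in X s @^-1` ball (c l) r) (F omega)%:E)%E.
Proof.
move=> s0 mF F0.
have mI l := measurable_hit_indic l (E := setT) s0.
under eq_integral do rewrite /weight mulr_suml -sumEFin.
rewrite ge0_integral_sum//; last 2 first.
- move=> l; apply/measurable_EFinP; apply: measurable_funM => //.
  exact: measurable_funM.
- by move=> l omega _; rewrite lee_fin !mulr_ge0.
apply: eq_bigr => l _; under eq_integral do rewrite -mulrA EFinM.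
rewrite ge0_integralZl_EFin//; last 2 first.
- by move=> omega _; rewrite lee_fin mulr_ge0.
- by apply/measurable_EFinP; apply: measurable_funM.
congr (_ * _)%E; rewrite [RHS]integral_mkcond; apply: eq_integral => omega _.
rewrite patchE; case: ifPn => h.
  by rewrite indicE; move: h; rewrite !inE => h; rewrite mem_set// mul1r.
by rewrite indicE memNset ?mul0r//; move: h => /negP; rewrite inE.
Qed.

Lemma measurable_mean_weight s u (E : set Omega) : 0 <= s -> 0 <= u ->
  measurable_fun E (fun omega => mean_weight (X s omega) u).
Proof.
move=> s0 u0; apply: emeasurable_sum => l; apply: emeasurable_funM => //.
by apply: (measurable_transition markov) => //; exact: measurable_ball_rV.
Qed.

Lemma markov_weight y s u E : 0 <= s -> 0 <= u -> measurable E ->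
  natural_filtration X s E ->
  (\int[P y]_(omega in E) (weight (X (s + u) omega))%:E =
   \int[P y]_(omega in E) mean_weight (X s omega) u)%E.
Proof.
move=> s0 u0 mE sE; rewrite integral_weight ?addr_ge0//.
have mt l : measurable_fun E (fun omega => P (X s omega) (X u @^-1` ball (c l) r)).
  by apply: (measurable_transition markov) => //; exact: measurable_ball_rV.
rewrite ge0_integral_sum//; last 2 first.
- by move=> l; apply: emeasurable_funM.
- by move=> l omega _; rewrite mule_ge0// lee_fin.
apply: eq_bigr => l _; rewrite ge0_integralZl_EFin//.
have [_ _ _ ->//] := markov; exact: measurable_ball_rV.
Qed.

Variables (b h : R).
Hypotheses (b_ge0 : 0 <= b) (h_gt0 : 0 < h).

Let jh0 (j : nat) : 0 <= j%:R * h.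
Proof. by rewrite mulr_ge0// ltW. Qed.

(** The Markov property at time [s]: given the past, the expected mass of the block is a
    [mean_weight] sum started at [X s], hence at most [kappa] wherever the path is. *)
Lemma integral_block_weight y s (M : nat) (kappa : R) E : 0 <= s ->
  measurable E -> natural_filtration X s E ->
  (forall v, (\sum_(j < M) b%:E * mean_weight v (j%:R * h) <= kappa%:E)%E) ->
  (\int[P y]_(omega in E) (\sum_(j < M) b * weight (X (s + j%:R * h) omega))%:E
    <= kappa%:E * P y E)%E.
Proof.
move=> s0 mE sE hkappa.
under eq_integral do rewrite -sumEFin.
rewrite ge0_integral_sum//; last 2 first.
- move=> j; apply/measurable_EFinP; apply: measurable_funM => //.
  by apply: measurable_weight; rewrite addr_ge0.
- by move=> j omega _; rewrite lee_fin mulr_ge0// weight_ge0.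
rewrite (eq_bigr (fun j : 'I_M => \int[P y]_(omega in E)
    (b%:E * mean_weight (X s omega) (j%:R * h)))%E); last first.
  move=> j _; under eq_integral do rewrite EFinM.
  rewrite ge0_integralZl_EFin//; last 2 first.
  - by move=> omega _; rewrite lee_fin weight_ge0.
  - by apply/measurable_EFinP; apply: measurable_weight; rewrite addr_ge0.
  rewrite markov_weight// ge0_integralZl_EFin//.
  - by move=> omega _; exact: mean_weight_ge0.
  - exact: measurable_mean_weight.
rewrite -ge0_integral_sum//; last 2 first.
- by move=> j; apply: emeasurable_funM => //; exact: measurable_mean_weight.
- by move=> j omega _; rewrite mule_ge0// ?lee_fin// mean_weight_ge0.
rewrite -integral_cst//; apply: ge0_le_integral_nonmeasurable => omega _ //.
by apply: sume_ge0 => j _; rewrite mule_ge0// ?lee_fin// mean_weight_ge0.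
Qed.

Let filtration_hit s l : 0 <= s -> natural_filtration X s (X s @^-1` ball (c l) r).
Proof.
move=> s0; apply: sub_sigma_algebra; exists s, (ball (c l) r).
by split => //; [rewrite s0 lexx|exact: measurable_ball_rV].
Qed.

Let filtration_setT s : 0 <= s -> natural_filtration X s setT.
Proof.
move=> s0; apply: sub_sigma_algebra; exists s, setT.
by split => //; rewrite s0 lexx.
Qed.

(** With [M = N] this controls the second moment of the total mass; with a small [M] it controls the
    pairs close to the diagonal. *)
Lemma integral_weight_pairs y ta (N M : nat) (kN kM : R) : 0 <= ta -> 0 <= kM ->
  (forall v, (\sum_(j < N) b%:E * mean_weight v (j%:R * h) <= kN%:E)%E) ->
  (forall v, (\sum_(j < M) b%:E * mean_weight v (j%:R * h) <= kM%:E)%E) ->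
  (\int[P y]_omega (\sum_(i < N) b * weight (X (ta + i%:R * h) omega) *
     \sum_(j < M) b * weight (X (ta + i%:R * h + j%:R * h) omega))%:E
    <= (kM * kN)%:E)%E.
Proof.
move=> ta0 kM0 hN hM.
have t0 (i : nat) : 0 <= ta + i%:R * h by rewrite addr_ge0.
have mF i : measurable_fun setT (fun omega =>
    \sum_(j < M) b * weight (X (ta + i%:R * h + j%:R * h) omega)).
  apply: measurable_sum => j; apply: measurable_funM => //.
  by apply: measurable_weight; rewrite addr_ge0.
have F0 i omega : 0 <= \sum_(j < M) b * weight (X (ta + i%:R * h + j%:R * h) omega).
  by apply: sumr_ge0 => j _; rewrite mulr_ge0// weight_ge0.
(* The weight at the [i]-th time is a combination of indicators of events known at that time. On
   each of them the following block contributes at most [kM] in conditional mean. *)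
have le1 (i : 'I_N) : (\int[P y]_omega (b * weight (X (ta + i%:R * h) omega) *
     \sum_(j < M) b * weight (X (ta + i%:R * h + j%:R * h) omega))%:E
    <= kM%:E * \int[P y]_omega (b * weight (X (ta + i%:R * h) omega))%:E)%E.
  under eq_integral do rewrite -mulrA EFinM.
  rewrite ge0_integralZl_EFin//; last 2 first.
  - by move=> omega _; rewrite lee_fin mulr_ge0// weight_ge0.
  - apply/measurable_EFinP; apply: measurable_funM => //.
    exact: measurable_weight.
  under [in leRHS]eq_integral do rewrite EFinM.
  rewrite (ge0_integralZl_EFin _ measurableT)//; last 2 first.
  - by move=> omega _; rewrite lee_fin weight_ge0.
  - by apply/measurable_EFinP; exact: measurable_weight.
  rewrite muleCA lee_wpmul2l ?lee_fin// integral_mul_weight// integral_weight//.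
  rewrite ge0_sume_distrr; last by move=> l _; rewrite mule_ge0// lee_fin.
  apply: lee_sum => l _; rewrite muleCA lee_wpmul2l ?lee_fin// setTI.
  by apply: integral_block_weight => //; [exact: measurable_hit|exact: filtration_hit].
under eq_integral do rewrite -sumEFin.
rewrite ge0_integral_sum//; last 2 first.
- move=> i; apply/measurable_EFinP; apply: measurable_funM => //.
  by apply: measurable_funM => //; exact: measurable_weight.
- by move=> i omega _; rewrite lee_fin !mulr_ge0// weight_ge0.
apply: le_trans; first by apply: lee_sum => i _; exact: le1.
rewrite -ge0_sume_distrr; last first.
  by move=> i _; apply: integral_ge0 => omega _; rewrite lee_fin mulr_ge0// weight_ge0.
rewrite EFinM lee_wpmul2l ?lee_fin//.
rewrite -ge0_integral_sum//; last 2 first.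
- move=> i; apply/measurable_EFinP; apply: measurable_funM => //.
  exact: measurable_weight.
- by move=> i omega _; rewrite lee_fin mulr_ge0// weight_ge0.
under eq_integral do rewrite sumEFin.
have := integral_block_weight y ta0 measurableT (filtration_setT ta0) hN.
by rewrite probability_setT mule1.
Qed.

End occupation.

(** * Comparison with the Kato potential *)

Section scale.
Context (R : realType) (n : nat) (leb : {measure set 'rV[R]_n -> \bar R}).
Context (d : measure_display) (Omega : measurableType d).
Variables (P : 'rV[R]_n -> probability Omega R) (X : R -> Omega -> 'rV[R]_n).
Variables (p : R -> 'rV[R]_n -> 'rV[R]_n -> R).
Hypothesis lebP : is_lebesgue leb.
Hypothesis markov : markov_process P X.
Hypothesis density : transition_density P X leb p.
Variables (A C : R) (rho : R -> R).
Hypotheses (A0 : 0 < A) (C0 : 0 < C).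
Hypothesis rho_gt0 : forall t, 0 < t <= 1 -> 0 < rho t.
Hypothesis rho_le : forall s t, 0 < s -> s <= t -> t <= 1 -> rho t <= rho s.
Hypothesis p_ge0 : forall t x y, 0 < t <= 1 -> 0 <= p t x y.
Hypothesis p_low : forall t x y, 0 < t <= 1 -> `|y - x| <= C / rho t ->
  A * rho t ^+ n <= p t x y.
Variables (L : nat) (q : 'I_L -> R) (c : 'I_L -> 'rV[R]_n) (r : R).
Hypothesis q_ge0 : forall l, 0 <= q l.
Hypothesis r_gt0 : 0 < r.

Local Notation mw := (mean_weight P X q c r).

(** From the ball around [z0], the density at time [s] is at least [A * rho (2 * delta) ^+ n] on the
    box of half-side [r / 2] around each [c l]; that box has volume [r ^+ n]. *)
Lemma mean_weight_ge x z0 R0 k delta s : 0 <= k -> 0 < delta -> 2 * delta <= 1 ->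
  delta <= s <= 2 * delta -> 0 < R0 -> r <= R0 -> 3 * R0 <= C / rho delta ->
  (forall l, `|z0 - c l| < R0) ->
  ((\sum_(l < L) q l)%:E * ((A * rho (2 * delta) ^+ n * r ^+ n)%:E *
     P x (X k @^-1` ball z0 R0)) <= mw x (k + s))%E.
Proof.
move=> k0 delta0 delta1 /andP[s1 s2] R00 rR0 R0C cR0.
rewrite -sumEFin ge0_sume_distrl; last by move=> l _; rewrite lee_fin.
apply: lee_sum => l _; rewrite lee_wpmul2l ?lee_fin//.
have s01 : 0 < s <= 1 by apply/andP; split; lra.
have d01 : 0 < delta <= 1 by apply/andP; split; lra.
have d201 : 0 < 2 * delta <= 1 by apply/andP; split; lra.
have rs : 0 < rho s by exact: rho_gt0.
have rd : 0 < rho delta by exact: rho_gt0.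
have rd2 : 0 < rho (2 * delta) by exact: rho_gt0.
have rsd : rho s <= rho delta by apply: rho_le => //; lra.
have rsd2 : rho (2 * delta) <= rho s by apply: rho_le => //; lra.
have r20 : 0 < r / 2 by rewrite divr_gt0.
have s0 : 0 <= s by lra.
have mball v t := measurable_ball_rV v t.
apply: (@le_trans _ _ (P x (X (k + s) @^-1` box (c l) (r / 2)))); last first.
  apply: le_measure; rewrite ?inE.
  - by apply: (measurable_preimage_process markov); [lra|exact: measurable_box].
  - by apply: (measurable_preimage_process markov); [lra|exact: mball].
  - move=> omega /= /box_norm/(_ (ltW r20)) hc.
    by rewrite mx_norm_ball /ball_/=; lra.
apply: (markov_ge markov) => //.
- exact: measurable_box.
- by rewrite ltW// !mulr_gt0// exprn_gt0.
move=> v; rewrite mx_norm_ball /ball_/= => z0v.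
apply: (@le_trans _ _ (A * rho s ^+ n * (2 * (r / 2)) ^+ n)%:E).
  rewrite lee_fin; have -> : 2 * (r / 2) = r by lra.
  rewrite ler_pM2r ?exprn_gt0// ler_pM2l//.
  by rewrite lerXn2r// nnegrE ltW.
apply: (prob_box_ge lebP density A0 rho_gt0 p_low) => // y cy.
apply: (@le_trans _ _ (C / rho delta)); last first.
  by rewrite ler_pM2l// lef_pV2.
rewrite (_ : y - v = (y - c l) + ((c l - z0) + (z0 - v))); last first.
  by rewrite !addrA !subrK.
have := ler_normD (y - c l) ((c l - z0) + (z0 - v)).
have := ler_normD (c l - z0) (z0 - v).
by have := cR0 l; rewrite (distrC y) (distrC (c l) z0); lra.
Qed.

Variable w : {measure set 'rV[R]_n -> \bar R}.
Variable Cl : 'I_L -> set 'rV[R]_n.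
Hypothesis mCl : forall l, measurable (Cl l).
Hypothesis Cl_disj : trivIset setT Cl.
Hypothesis Cl_ball : forall l, Cl l `<=` ball (c l) r.
Hypothesis w_Cl : forall l, w (Cl l) = (q l)%:E.

Variables (eps h : R).
Hypotheses (eps0 : 0 < eps) (h0 : 0 < h) (eps1 : eps + h <= 1).
Hypothesis rho_eps : rho eps <= 2 * rho (eps + h).
Hypothesis r_eps : 3 * r <= C / rho eps.

(** By [rho_eps] and monotonicity, [rho eps / 2] is a lower bound for [rho] on the whole interval
    from [eps] to [eps + h]. *)
Let beta := A * (rho eps / 2) ^+ n.

Let beta_gt0 : 0 < beta.
Proof.
move: h0 eps1 => h_gt0 eps_h1.
by rewrite mulr_gt0// exprn_gt0// divr_gt0// rho_gt0// eps0/=; lra.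
Qed.

(** Each cell lies in its ball, so [prob_ball_le_density] holds at all its points; it is integrated
    against [w] over the cell and summed over the disjoint cells. *)
Lemma mean_weight_le_potential y s u : 0 <= s -> eps <= u <= eps + h ->
  s + u <= 1 -> (beta%:E * mw y s <= \int[w]_z (p (s + u) y z)%:E)%E.
Proof.
move: eps0 h0 eps1 => eps_gt0 h_gt0 eps_h1 s0 /andP[u1 u2] su1.
have u0 : 0 < u by lra.
have su0 : 0 < s + u by lra.
have u01 : 0 < u <= 1 by apply/andP; split; lra.
have e01 : 0 < eps <= 1 by apply/andP; split; lra.
have re : 0 < rho eps by exact: rho_gt0.
have ru : 0 < rho u by exact: rho_gt0.
have rue : rho u <= rho eps by apply: rho_le => //; lra.
have rue2 : rho (eps + h) <= rho u by apply: rho_le => //; lra.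
have rue2h : rho eps / 2 <= rho u.
  by rewrite ler_pdivrMr//; move: rho_eps => ?; lra.
have mp B : measurable_fun B (fun z => (p (s + u) y z)%:E).
  apply: measurable_funTS; apply/measurable_EFinP.
  apply: continuous_measurable_rV.
  exact: (transition_density_continuous density su0).
have p0 z : (0 <= (p (s + u) y z)%:E)%E.
  by rewrite lee_fin p_ge0// su0.
apply: (@le_trans _ _
    (\int[w]_(z in \big[setU/set0]_(l < L) Cl l) (p (s + u) y z)%:E)%E); last first.
  by apply: ge0_subset_integral => //; exact: bigsetU_measurable.
rewrite ge0_integral_bigsetU//; last 2 first.
- exact: index_enum_uniq.
- exact: sub_trivIset Cl_disj.
rewrite /mean_weight ge0_sume_distrr; last first.
  by move=> l _; rewrite mule_ge0// lee_fin.
apply: lee_sum => l _.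
have Pfin : P y (X s @^-1` ball (c l) r) \is a fin_num.
  apply: fin_num_measure; apply: (measurable_preimage_process markov) => //.
  exact: measurable_ball_rV.
rewrite muleCA -w_Cl muleC -(fineK Pfin) -EFinM -integral_cst//.
apply: ge0_le_integral_nonmeasurable => z zl /=.
  by rewrite lee_fin mulr_ge0 ?(ltW beta_gt0)// fine_ge0.
rewrite EFinM (fineK Pfin).
apply: le_trans
  (prob_ball_le_density lebP markov density A0 rho_gt0 p_ge0 p_low y s0 u0 su1
    r_gt0 _ (z := z) (c := c l) _).
- rewrite lee_wpmul2r// lee_fin ler_pM2l// lerXn2r// nnegrE ?divr_ge0//.
  + exact: ltW.
  + exact: ltW.
- by rewrite (le_trans r_eps)// ler_pM2l// lef_pV2.
- by have := Cl_ball zl; rewrite mx_norm_ball.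
Qed.

(* The j-th term is bounded by the potential at every time between j h + eps and
   (j + 1) h + eps, so the sum is the integral of a step function lying below the
   (possibly non-measurable) integrand in [s]. *)
Lemma sum_mean_weight_le_kato y (M : nat) (T : R) : M%:R * h + eps <= T ->
  T <= 1 ->
  (\sum_(j < M) (h * beta)%:E * mw y (j%:R * h) <=
   \int[lebesgue_measure]_(s in `]0%R, T[) \int[w]_z (p s y z)%:E)%E.
Proof.
move: eps0 h0 => eps_gt0 h_gt0 MT T1.
have mwfin s : 0 <= s -> mw y s \is a fin_num.
  move=> s0; apply/sum_fin_numP => l _ _; rewrite fin_numM//.
  apply: fin_num_measure; apply: (measurable_preimage_process markov) => //.
  exact: measurable_ball_rV.
have jh0 (j : nat) : 0 <= j%:R * h by rewrite mulr_ge0// ltW.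
pose e (j : nat) := beta * fine (mw y (j%:R * h)).
have e0 j : 0 <= e j.
  by rewrite mulr_ge0 ?(ltW beta_gt0)// fine_ge0// mean_weight_ge0.
pose I (j : nat) : set R := `]j%:R * h + eps, j.+1%:R * h + eps[%classic.
have jS (j : nat) : j.+1%:R * h = j%:R * h + h.
  by rewrite -natr1 mulrDl mul1r.
have leI (j : nat) : lebesgue_measure (I j) = h%:E.
  rewrite /I lebesgue_measure_itv/= lte_fin jS ifT; last by lra.
  by rewrite -EFinD; congr EFin; lra.
have IT j : (j < M)%N -> I j `<=` `]0, T[%classic.
  move=> jM s; rewrite /I /= !in_itv/= => /andP[s1 s2].
  have : j.+1%:R * h <= M%:R * h by rewrite ler_pM2r// ler_nat.
  by have := jh0 j; move=> ? ?; apply/andP; split; lra.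
apply: (@le_trans _ _ (\int[lebesgue_measure]_(s in `]0%R, T[)
    (\sum_(j < M) e j * \1_(I j) s)%:E)%E).
  under eq_integral do rewrite -sumEFin.
  rewrite ge0_integral_sum//; last 2 first.
  - move=> j; apply/measurable_EFinP; apply: measurable_funM => //.
    by apply: measurable_indic; exact: measurable_itv.
  - by move=> j s _; rewrite lee_fin mulr_ge0.
  apply: lee_sum => j _; under eq_integral do rewrite EFinM.
  rewrite ge0_integralZl_EFin//; last first.
    by apply/measurable_EFinP; apply: measurable_indic; exact: measurable_itv.
  rewrite integral_indic//; last exact: measurable_itv.
  rewrite setIidl; last exact: IT.
  rewrite [X in (_ <= _ * X)%E](leI j) -(fineK (mwfin _ (jh0 j))) -!EFinM lee_fin /e le_eqVlt.
  by apply/orP; left; apply/eqP; ring.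
apply: ge0_le_integral_nonmeasurable => s.
  by move=> _; rewrite lee_fin sumr_ge0// => j _; rewrite mulr_ge0.
rewrite /= in_itv/= => /andP[s0 sT].
have [[j sj]|nj] := pselect (exists j : 'I_M, I j s); last first.
  rewrite big1 ?integral_ge0//.
    by move=> z _; rewrite lee_fin p_ge0// s0; lra.
  by move=> j _; rewrite indicE memNset ?mulr0// => sj; apply: nj; exists j.
rewrite (bigD1 j)//= big1 ?addr0; last first.
  move=> k kj; rewrite indicE memNset ?mulr0// => sk.
  move: sj sk kj; rewrite /I /= !in_itv/= => /andP[j1 j2] /andP[k1 k2].
  have [kj|jk|/val_inj->] := ltngtP (k : nat) (j : nat).
  - have : k.+1%:R * h <= j%:R * h by rewrite ler_pM2r// ler_nat.
    by move=> ? _; lra.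
  - have : j.+1%:R * h <= k%:R * h by rewrite ler_pM2r// ler_nat.
    by move=> ? _; lra.
  - by rewrite eqxx.
rewrite indicE mem_set// mulr1 /e EFinM fineK ?mwfin//.
move: sj; rewrite /I /= in_itv/= jS => /andP[s1 s2].
rewrite [X in p X](_ : s = j%:R * h + (s - j%:R * h)); last by lra.
by apply: mean_weight_le_potential => //; [apply/andP; split; lra|lra].
Qed.

End scale.

(** * Second moment method *)

(** Expanding the square, by symmetry twice the ordered pairs suffice, and two selected indices are
    less than [M] apart. *)
Lemma block_sqr_le (R : realType) (a : nat -> R) (N M : nat) (I : pred nat) :
  (forall i, 0 <= a i) ->
  (forall i j, I i -> I j -> (i < N)%N -> (j < N)%N -> (i <= j)%N -> (j < i + M)%N) ->
  (\sum_(i < N | I i) a i) ^+ 2 <=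
    2 * \sum_(i < N) a i * \sum_(j < M) a (i + j)%N.
Proof.
move=> a0 IM.
have inner (i : 'I_N) : I i ->
    \sum_(j < N | I j && (i <= j)%N) a j <= \sum_(j < M) a (i + j)%N.
  move=> Ii; pose K := maxn N (i + M).
  have -> : \sum_(j < M) a (i + j)%N = \sum_(i <= j < i + M) a j.
    have -> : \sum_(i <= j < i + M) a j = \sum_(0 <= j < M) a (j + i)%N.
      by rewrite -{1}[nat_of_ord i]add0n big_addn addKn.
    rewrite big_mkord.
    by apply: eq_bigr => j _; rewrite addnC.
  rewrite -(big_mkord (fun j => I j && (i <= j)%N) a).
  have -> : \sum_(0 <= j < N | I j && (i <= j)%N) a j =
      \sum_(0 <= j < K | I j && (i <= j)%N && (j < N)%N) a j.
    by rewrite (big_nat_widen _ _ K) ?leq_maxl.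
  have -> : \sum_(i <= j < i + M) a j =
      \sum_(0 <= j < K | (j < i + M)%N && (i <= j)%N) a j.
    by rewrite (big_nat_widen _ _ K) ?leq_maxr// (big_nat_widenl _ 0).
  rewrite [leLHS]big_mkcond [leRHS]big_mkcond; apply: ler_sum => j _.
  case: ifPn => [/andP[/andP[Ij ij] jN]|_]; last by case: ifPn.
  by rewrite (IM i j)//= ij.
have sym : \sum_(i < N | I i) \sum_(j < N | I j && (j <= i)%N) a i * a j =
    \sum_(i < N | I i) \sum_(j < N | I j && (i <= j)%N) a i * a j.
  rewrite (exchange_big_dep (fun j : 'I_N => I j))/=; last first.
    by move=> i j _ /andP[].
  apply: eq_bigr => i Ii; rewrite (eq_bigl (fun j : 'I_N => I j && (i <= j)%N)).
    by apply: eq_bigr => j _; rewrite mulrC.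
  by move=> j; rewrite Ii.
(* The diagonal is counted in both halves, which is harmless for an upper bound. *)
apply: (@le_trans _ _ (2 * \sum_(i < N | I i)
    \sum_(j < N | I j && (i <= j)%N) a i * a j)).
  rewrite mulr2n mulrDl mul1r -{1}sym -big_split/= expr2 mulr_suml.
  apply: ler_sum => i Ii; rewrite mulr_sumr.
  rewrite [leLHS](bigID (fun j : 'I_N => (j <= i)%N))/= lerD2l.
  rewrite big_mkcond [leRHS]big_mkcond; apply: ler_sum => j _.
  case: ifPn => [/andP[Ij]|_].
    by rewrite -ltnNge => /ltnW ij; rewrite Ij ij.
  by case: ifPn => // _; rewrite mulr_ge0.
rewrite ler_pM2l//; apply: (@le_trans _ _
    (\sum_(i < N | I i) a i * \sum_(j < M) a (i + j)%N)).
  apply: ler_sum => i Ii; rewrite -mulr_sumr ler_wpM2l//; exact: inner.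
rewrite big_mkcond; apply: ler_sum => i _; case: ifPn => // _.
by rewrite mulr_ge0// sumr_ge0.
Qed.

Section probability_bounds.
Context (R : realType) (d : measure_display) (Omega : measurableType d).
Variable Pr : probability Omega R.

Let measurable_gt (f : Omega -> R) (t : R) : measurable_fun setT f ->
  measurable [set omega | t < f omega].
Proof.
move=> mf; rewrite (_ : [set _ | _] = setT `&` f @^-1` `]t, +oo[).
  by apply: mf => //; exact: measurable_itv.
by apply/seteqP; split => omega /=; rewrite in_itv/= andbT => //; case.
Qed.

(** A Paley-Zygmund inequality, by integrating the pointwise bound [pt]. The level [L] is chosen so
    that the quadratic term has mean at most [a / 4]; this leaves [a / 2 <= L * Pr B]. *)
Lemma prob_gt_second_moment (S : Omega -> R) (a c2 : R) :
  measurable_fun setT S -> (forall omega, 0 <= S omega) -> 0 < a -> 0 < c2 ->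
  (a%:E <= \int[Pr]_omega (S omega)%:E)%E ->
  (\int[Pr]_omega (S omega ^+ 2)%:E <= c2%:E)%E ->
  ((a ^+ 2 / (8 * c2))%:E <= Pr [set omega | (a / 4 < S omega)%R])%E.
Proof.
move=> mS S0 a0 c20 aS Sc2; pose L := 4 * c2 / a.
have L0 : 0 < L by rewrite divr_gt0// mulr_gt0.
pose B := [set omega | a / 4 < S omega].
have mB : measurable B by exact: measurable_gt.
have Bfin : Pr B \is a fin_num by exact: fin_num_measure.
have mI : measurable_fun setT (\1_B : Omega -> R) by exact: measurable_indic.
have mS2 : measurable_fun setT (fun omega => S omega ^+ 2) by exact: measurable_funX.
have pt omega : S omega <= a / 4 + L * \1_B omega + L^-1 * S omega ^+ 2.
  have q0 : 0 <= L^-1 * S omega ^+ 2 by rewrite mulr_ge0 ?sqr_ge0// invr_ge0 ltW.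
  have [h|h] := leP (S omega) (a / 4).
    have : 0 <= L * \1_B omega by rewrite mulr_ge0// ltW.
    by lra.
  rewrite indicE mem_set// mulr1.
  have [hL|hL] := leP (S omega) L; first by lra.
  have : S omega <= L^-1 * S omega ^+ 2.
    by rewrite ler_pdivlMl// expr2 ler_pM2r ?ltW//; lra.
  by lra.
have : (a%:E <= (a / 4)%:E + L%:E * Pr B + L^-1%:E * c2%:E)%E.
  apply: (le_trans aS); apply: (@le_trans _ _
    (\int[Pr]_omega ((a / 4)%:E + L%:E * (\1_B omega)%:E +
      L^-1%:E * (S omega ^+ 2)%:E))%E).
    apply: ge0_le_integral_nonmeasurable => omega _; first by rewrite lee_fin.
    by rewrite -!EFinM -!EFinD lee_fin.
  have mLI : measurable_fun setT (fun omega => L%:E * (\1_B omega)%:E)%E.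
    by apply: emeasurable_funM => //; exact/measurable_EFinP.
  have mLS : measurable_fun setT (fun omega => L^-1%:E * (S omega ^+ 2)%:E)%E.
    by apply: emeasurable_funM => //; exact/measurable_EFinP.
  have LI0 omega : (0 <= L%:E * (\1_B omega)%:E)%E.
    by rewrite mule_ge0// lee_fin ltW.
  have LS0 omega : (0 <= L^-1%:E * (S omega ^+ 2)%:E)%E.
    by rewrite mule_ge0// lee_fin ?sqr_ge0// invr_ge0 ltW.
  have a40 : (0 <= (a / 4)%:E)%E by rewrite lee_fin; lra.
  rewrite ge0_integralD//; last 2 first.
  - by move=> omega _; rewrite adde_ge0.
  - exact: emeasurable_funD.
  rewrite ge0_integralD//.
  have -> : (\int[Pr]_omega (a / 4)%:E = (a / 4)%:E)%E.
    by rewrite integral_cst//= probability_setT mule1.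
  rewrite ge0_integralZl_EFin//; last 2 first.
  - exact/measurable_EFinP.
  - exact: ltW.
  have -> : (\int[Pr]_omega (\1_B omega)%:E = Pr B)%E.
    by rewrite integral_indic// setIT.
  apply: leeD => //; rewrite ge0_integralZl_EFin//.
  - by rewrite lee_wpmul2l// lee_fin invr_ge0 ltW.
  - by move=> omega _; rewrite lee_fin sqr_ge0.
  - exact/measurable_EFinP.
  - by rewrite invr_ge0 ltW.
rewrite -(fineK Bfin) -!EFinM -!EFinD !lee_fin.
have -> : L^-1 * c2 = a / 4.
  by rewrite /L; field; rewrite !gt_eqF.
move=> h; have h2 : a / 2 <= L * fine (Pr B) by lra.
rewrite ler_pdivrMr ?mulr_gt0//.
have : a * (a / 2) <= a * (L * fine (Pr B)) by rewrite ler_pM2l.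
have -> : a * (L * fine (Pr B)) = 4 * c2 * fine (Pr B).
  by rewrite /L; field; rewrite gt_eqF.
by rewrite expr2; lra.
Qed.

Lemma markov_inequality_gt (W : Omega -> R) (t e : R) : 0 < t ->
  measurable_fun setT W -> (forall omega, 0 <= W omega) ->
  (\int[Pr]_omega (W omega)%:E <= (t * e)%:E)%E ->
  (Pr [set omega | (t < W omega)%R] <= e%:E)%E.
Proof.
move=> t0 mW W0 We; pose B := [set omega | t < W omega]; rewrite -/B.
have mB : measurable B by exact: measurable_gt.
have Bfin : Pr B \is a fin_num by exact: fin_num_measure.
rewrite -(fineK Bfin) lee_fin -(ler_pM2l t0) -lee_fin; apply: le_trans We.
rewrite EFinM fineK// -integral_cst//.
apply: (@le_trans _ _ (\int[Pr]_(omega in B) (W omega)%:E)%E).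
  apply: ge0_le_integral_nonmeasurable => omega /=.
    by rewrite lee_fin ltW.
  by rewrite /B /= lee_fin => /ltW.
apply: ge0_subset_integral => //; first exact/measurable_EFinP.
by move=> omega _; rewrite lee_fin.
Qed.

(** By Markov's inequality the [l]-th bad event costs at most [p0 / 2 ^+ l.+2], and these costs sum
    to less than [p0 / 2]. *)
Lemma prob_good_event (B : set Omega) (p0 : R) (W : nat -> Omega -> R)
    (t : nat -> R) (k : nat) :
  measurable B -> 0 <= p0 -> (p0%:E <= Pr B)%E ->
  (forall l, measurable_fun setT (W l)) -> (forall l omega, 0 <= W l omega) ->
  (forall l, 0 < t l) ->
  (forall l, (l < k)%N ->
    (\int[Pr]_omega (W l omega)%:E <= (t l * (p0 / 2 ^+ l.+2))%:E)%E) ->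
  exists G, [/\ measurable G, G `<=` B, ((p0 / 2)%:E <= Pr G)%E &
    forall omega, G omega -> forall l, (l < k)%N -> W l omega <= t l].
Proof.
move=> mB p00 p0B mW W0 t0 Wk.
(* Strengthened for the induction: the extra [p0 / 2 ^+ k.+1] is what the later removals may still
   consume. *)
suff [G [mG GB PG GW]] : exists G, [/\ measurable G, G `<=` B,
    ((p0 / 2 + p0 / 2 ^+ k.+1)%:E <= Pr G)%E &
    forall omega, G omega -> forall l, (l < k)%N -> W l omega <= t l].
  exists G; split => //; apply: le_trans PG; rewrite lee_fin lerDl.
  by rewrite divr_ge0// exprn_ge0.
elim: k Wk => [_|k IH Wk].
  exists B; split => //; apply: le_trans p0B; rewrite lee_fin expr1; lra.
have [|G [mG GB PG GW]] := IH; first by move=> l lk; apply: Wk; exact: ltnW.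
have mBk : measurable [set omega | t k < W k omega] by exact: measurable_gt.
have PBk := markov_inequality_gt (t0 k) (mW k) (W0 k) (Wk k (leqnn _)).
exists (G `\` [set omega | t k < W k omega]); split.
- exact: measurableD.
- by move=> omega [/GB].
- have mGD := measurableD mG mBk.
  have Gfin : Pr G \is a fin_num by exact: fin_num_measure.
  have Dfin : Pr (G `\` [set omega | t k < W k omega]) \is a fin_num.
    exact: fin_num_measure.
  have Bkfin : Pr [set omega | t k < W k omega] \is a fin_num.
    exact: fin_num_measure.
  have : (Pr G <= Pr (G `\` [set omega | (t k < W k omega)%R]) +
      Pr [set omega | (t k < W k omega)%R])%E.
    apply: (@le_trans _ _ (Pr ((G `\` [set omega | t k < W k omega]) `|`
      [set omega | t k < W k omega]))); last exact: measureU2.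
    apply: le_measure; rewrite ?inE//; first exact: measurableU.
    by move=> omega Go; have [h|h] := pselect (t k < W k omega); [right|left].
  move: PG PBk; rewrite -(fineK Gfin) -(fineK Dfin) -(fineK Bkfin) -EFinD !lee_fin.
  have : p0 / 2 ^+ k.+1 = 2 * (p0 / 2 ^+ k.+2).
    by rewrite (exprS _ k.+1); field; rewrite expf_neq0.
  by move=> -> h1 h2 h3; lra.
- move=> omega [Go /negP]; rewrite -leNgt => Wko l; rewrite ltnS leq_eqVlt.
  by move=> /predU1P[->//|]; exact: GW.
Qed.

(** The unions of tails decrease to the upper limit and each has probability at least [p0]. *)
Lemma prob_lim_sup_set_ge (G : nat -> set Omega) (p0 : \bar R) :
  (forall k, measurable (G k)) -> (forall k, (p0 <= Pr (G k))%E) ->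
  (p0 <= Pr (lim_sup_set G))%E.
Proof.
move=> mG p0G; rewrite leNgt; apply/negP => lt0.
have mU m : measurable (\bigcup_(j >= m) G j) by exact: bigcup_measurable.
have Uoo : (Pr (\bigcup_(j >= 0) G j) < +oo)%E.
  exact: le_lt_trans (probability_le1 _ (mU 0%N)) (ltry _).
have [m /(_ m (leqnn _))] := cvge_near_lt (lim_sup_set_cvg Pr G mG Uoo) lt0.
rewrite ltNge => /negP; apply; apply: (le_trans (p0G m)).
by apply: le_measure; rewrite ?inE// => omega Go; exists m => //=.
Qed.

End probability_bounds.

(** * Hitting a compact set *)

(** A finite subcover by balls centred in [K], made disjoint by removing from each ball the
    preceding ones. *)
Lemma compact_ball_partition (R : realType) (n : nat) (K : set 'rV[R]_n) (r : R) :
  compact K -> measurable K -> 0 < r ->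
  exists (L : nat) (c : 'I_L -> 'rV[R]_n) (Cl : 'I_L -> set 'rV[R]_n),
  [/\ forall l, K (c l), forall l, measurable (Cl l), trivIset setT Cl,
      forall l, Cl l `<=` K `&` ball (c l) r & K = \big[setU/set0]_(l < L) Cl l].
Proof.
move=> cK mK r0; move: cK; rewrite compact_cover.
move=> /(_ 'rV[R]_n K (fun x => ball x r))[].
- by move=> x _; exact: ball_open.
- by move=> x Kx; exists x => //; exact: ballxx.
move=> D' D'K KD'; pose s := finmap.enum_fset D'.
pose F i := K `&` ball (nth 0 s i) r.
have mF i : measurable (F i).
  by apply: measurableI => //; exact: measurable_ball_rV.
exists (size s), (fun l => nth 0 s l), (fun l => seqDU F l); split.
- by move=> l; apply: set_mem; apply: D'K; exact: (mem_nth 0 (ltn_ord l)).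
- by move=> l; apply: measurableD => //; exact: bigsetU_measurable.
- apply/trivIsetP => i j _ _ ij; move/trivIsetP : (trivIset_seqDU F); apply => //.
- by move=> l y [].
- rewrite -(bigsetU_seqDU F); apply/seteqP; split => y.
    move=> Ky; have [x /= xD' xy] := KD' y Ky.
    rewrite -bigcup_mkord; exists (index x s) => /=; first by rewrite index_mem.
    by split => //; rewrite nth_index.
  by rewrite -bigcup_mkord => -[i _ []].
Qed.

Section hitting.
Context (R : realType) (n : nat) (leb : {measure set 'rV[R]_n -> \bar R}).
Context (d : measure_display) (Omega : measurableType d).
Variables (P : 'rV[R]_n -> probability Omega R) (X : R -> Omega -> 'rV[R]_n).
Variables (p : R -> 'rV[R]_n -> 'rV[R]_n -> R).
Hypothesis lebP : is_lebesgue leb.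
Hypothesis markov : markov_process P X.
Hypothesis density : transition_density P X leb p.
Variables (A C : R) (rho : R -> R).
Hypotheses (A0 : 0 < A) (C0 : 0 < C).
Hypothesis rho_gt0 : forall t, 0 < t <= 1 -> 0 < rho t.
Hypothesis rho_le : forall s t, 0 < s -> s <= t -> t <= 1 -> rho t <= rho s.
Hypothesis rho_infty : forall M, 0 < M -> exists2 t0, 0 < t0 &
  forall t, 0 < t -> t < t0 -> t <= 1 -> M <= rho t.
Hypothesis p_ge0 : forall t x y, 0 < t <= 1 -> 0 <= p t x y.
Hypothesis p_low : forall t x y, 0 < t <= 1 -> `|y - x| <= C / rho t ->
  A * rho t ^+ n <= p t x y.
Variable w : {measure set 'rV[R]_n -> \bar R}.

Section at_one_scale.
Variables (x z0 : 'rV[R]_n) (delta : R) (k0 : nat) (K : set 'rV[R]_n).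
Hypotheses (delta0 : 0 < delta) (delta1 : 4 * delta <= 1).
(** Three displacements of at most [R0] stay within the range of the lower density bound at time
    [delta]. *)
Let R0 := C / rho delta / 3.
Hypothesis kato1 : forall y,
  (\int[lebesgue_measure]_(s in `]0%R, (4 * delta)%R[) \int[w]_z (p s y z)%:E <= 1)%E.
Hypotheses (cK : compact K) (mK : measurable K) (KR0 : K `<=` ball z0 R0).
Hypotheses (wK0 : (0 < w K)%E) (wKoo : (w K < +oo)%E).
Hypothesis hk0 : (0 < P x (X k0%:R @^-1` ball z0 R0))%E.

(** A lower bound for the expected total mass that does not depend on the scale: [delta / 2] bounds
    the length of the time grid from below, and [A * (C / 6) ^+ n] is the product of [beta] and
    [r ^+ n]. *)
Definition mass_bound : R := delta / 2 * (A * (C / 6) ^+ n) * (fine (w K) *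
  (A * rho (2 * delta) ^+ n * fine (P x (X k0%:R @^-1` ball z0 R0)))).

(** The bound of [prob_gt_second_moment] for mean [mass_bound] and second moment at most [2]. *)
Definition event_bound : R := mass_bound ^+ 2 / (8 * 2).

Definition block_tol (l : nat) : R := l.+1%:R^-1.

(** By [block_sqr_le], a pair sum below this tolerance forces each short block to carry at most
    [block_tol l]. *)
Definition pair_tol (l : nat) : R := block_tol l ^+ 2 / 2.

Variable T : nat -> R.
Hypothesis T01 : forall l, 0 < T l <= 1.
Hypothesis katoT : forall l y, (\int[lebesgue_measure]_(s in `]0%R, T l[)
  \int[w]_z (p s y z)%:E <= (pair_tol l * (event_bound / 2 ^+ l.+2))%:E)%E.

Let Pfin (E : set 'rV[R]_n) s : 0 <= s -> measurable E ->
  P x (X s @^-1` E) \is a fin_num.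
Proof.
move=> s0 mE; apply: fin_num_measure.
exact: (measurable_preimage_process markov).
Qed.

Lemma mass_bound_gt0 : 0 < mass_bound.
Proof.
rewrite /mass_bound !mulr_gt0// ?exprn_gt0// ?divr_gt0//.
- by rewrite fine_gt0// wK0.
- by apply: rho_gt0; move: delta0 delta1 => ? ?; apply/andP; split; lra.
- rewrite fine_gt0// hk0/= ltey_eq Pfin//; exact: measurable_ball_rV.
Qed.

Lemma event_bound_gt0 : 0 < event_bound.
Proof. by rewrite divr_gt0// exprn_gt0// mass_bound_gt0. Qed.

Lemma pair_tol_gt0 l : 0 < pair_tol l.
Proof. by rewrite divr_gt0// exprn_gt0// invr_gt0. Qed.

Let ex_small (k : nat) : exists2 tau, 0 < tau & forall l, (l < k)%N -> tau <= T l / 2.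
Proof.
elim: k => [|k [tau tau0 IH]]; first by exists 1.
have /andP[Tk0 _] := T01 k.
exists (Num.min tau (T k / 2)); first by rewrite lt_min tau0 divr_gt0.
move=> l; rewrite ltnS leq_eqVlt => /predU1P[->|/IH h].
  by rewrite ge_min lexx orbT.
by rewrite ge_min h.
Qed.

Let ta := k0%:R + delta.

(** The constants for mass, probability and tolerance do not depend on [k], so the events can be
    combined as [k] grows. Only the tolerances [l < k] are imposed, since the grid must be fine
    compared with each [T l]. *)
Lemma scale_event (k : nat) : exists (N : nat) (h : R) (nu : nat -> Omega -> R)
    (G : set Omega),
  [/\ measurable G /\ ((event_bound / 2)%:E <= P x G)%E,
      0 < h /\ N%:R * h <= delta,
      forall i omega, 0 <= nu i omega,
      forall i omega, 0 < nu i omega ->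
        exists2 z, K z & `|X (ta + i%:R * h) omega - z| < k.+1%:R^-1 &
      forall omega, G omega -> mass_bound / 4 < \sum_(i < N) nu i omega /\
        forall l, (l < k)%N -> forall u v, v - u <= T l / 2 ->
        \sum_(i < N | u < ta + i%:R * h <= v) nu i omega <= block_tol l].
Proof.
move: delta0 delta1 => d0 d1.
have [tau tau0 htau] := ex_small k.
have [t0 t00 ht0] : exists2 t0, 0 < t0 &
    forall t, 0 < t -> t < t0 -> t <= 1 -> C * k.+1%:R <= rho t.
  by apply: rho_infty; rewrite mulr_gt0.
(* The three bounds serve, in order, the windows of length [T l], the length of the time grid, and
   the spatial precision [1 / (k + 1)]. *)
pose eta := Num.min tau (Num.min (delta / 2) t0).
have eta0 : 0 < eta by rewrite /eta !lt_min tau0 t00 divr_gt0.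
have [eps [h [eps0 h0 epsh epsh1 rho_eps]]] :=
  nonincreasing_comparable_scale rho_gt0 rho_le eta0.
have eta_tau : eta <= tau by rewrite /eta ge_min lexx.
have eta_delta : eta <= delta / 2 by rewrite /eta !ge_min lexx orbT.
have eta_t0 : eta <= t0 by rewrite /eta !ge_min lexx !orbT.
have e01 : 0 < eps <= 1 by apply/andP; split; lra.
have d01 : 0 < delta <= 1 by apply/andP; split; lra.
have d201 : 0 < 2 * delta <= 1 by apply/andP; split; lra.
have re : 0 < rho eps by exact: rho_gt0.
have rd : 0 < rho delta by exact: rho_gt0.
have rd2 : 0 < rho (2 * delta) by exact: rho_gt0.
have red : rho delta <= rho eps by apply: rho_le => //; lra.
pose r := C / rho eps / 3.
have r0 : 0 < r by rewrite !divr_gt0.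
have rR0 : r <= R0.
  by rewrite /r /R0 ler_pM2r// ler_pM2l// lef_pV2.
have rk : r < k.+1%:R^-1.
  have h1 : C * k.+1%:R <= rho eps by apply: ht0; lra.
  have : C / rho eps <= k.+1%:R^-1.
    by rewrite ler_pdivrMr// mulrC ler_pdivlMr.
  have : 0 < C / rho eps by rewrite divr_gt0.
  by rewrite /r; set D0 := C / rho eps; set D1 := k.+1%:R^-1 => *; lra.
have r_eps : 3 * r <= C / rho eps by rewrite /r; lra.
have R0_gt0 : 0 < R0 by rewrite !divr_gt0.
have R0_d : 3 * R0 <= C / rho delta by rewrite /R0; lra.
have [L [c [Cl [cK' mCl Cl_disj Cl_sub KCl]]]] := compact_ball_partition cK mK r0.
have Cl_ball l : Cl l `<=` ball (c l) r by move=> y /Cl_sub[].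
have wCl_fin l : w (Cl l) \is a fin_num.
  rewrite ge0_fin_numE ?measure_ge0//; apply: le_lt_trans wKoo.
  apply: le_measure; rewrite ?inE//.
  by move=> y /Cl_sub[].
pose q l := fine (w (Cl l)).
have q_ge0 l : 0 <= q l by rewrite fine_ge0.
have w_Cl l : w (Cl l) = (q l)%:E by rewrite fineK.
have sum_q : \sum_(l < L) q l = fine (w K).
  apply: EFin_inj; rewrite fineK; last by rewrite ge0_fin_numE// measure_ge0.
  rewrite -sumEFin KCl measure_bigsetU_ord//.
  by apply: eq_bigr => l _; exact/esym/w_Cl.
pose beta := A * (rho eps / 2) ^+ n.
have beta0 : 0 < beta by rewrite mulr_gt0// exprn_gt0// divr_gt0.
pose b := h * beta.
have b0 : 0 < b by rewrite mulr_gt0.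
pose nu (i : nat) omega := b * weight q c r (X (ta + i%:R * h) omega).
have ta0 : 0 <= ta by rewrite addr_ge0// ltW.
have t_ge0 (i : nat) : 0 <= ta + i%:R * h by rewrite addr_ge0// mulr_ge0// ltW.
have nu0 i omega : 0 <= nu i omega by rewrite mulr_ge0 ?weight_ge0// ltW.
have mnu i : measurable_fun setT (nu i).
  by apply: measurable_funM => //; exact: (measurable_weight markov).
have trn (t : R) : 0 <= t -> (Num.truncn (t / h))%:R * h <= t /\
    t < (Num.truncn (t / h)).+1%:R * h.
  move=> t_ge; have : 0 <= t / h by rewrite divr_ge0// ltW.
  by move=> /truncn_itv/andP[]; rewrite ler_pdivlMr// ltr_pdivrMr.
pose N := Num.truncn (delta / h).
have [Nd dN] := trn _ (ltW d0).
rewrite -/N in Nd dN.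
have Nd2 : delta / 2 <= N%:R * h.
  by move: dN; rewrite -natr1 mulrDl mul1r; lra.
have pot (M : nat) (t : R) v : M%:R * h + eps <= t -> t <= 1 ->
    (\sum_(j < M) b%:E * mean_weight P X q c r v (j%:R * h) <=
     \int[lebesgue_measure]_(s in `]0%R, t[) \int[w]_z (p s v z)%:E)%E.
  exact: (sum_mean_weight_le_kato lebP markov density A0 C0 rho_gt0 rho_le p_ge0
    p_low q_ge0 r0 mCl Cl_disj Cl_ball w_Cl eps0 h0 epsh1 rho_eps r_eps).
have potN v : (\sum_(j < N) b%:E * mean_weight P X q c r v (j%:R * h) <= 1%:E)%E.
  by apply: le_trans (kato1 v); apply: pot; lra.
pose kappa l := pair_tol l * (event_bound / 2 ^+ l.+2).
have kappa0 l : 0 <= kappa l.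
  apply: mulr_ge0; first exact/ltW/pair_tol_gt0.
  by apply: divr_ge0; [exact/ltW/event_bound_gt0|exact: exprn_ge0].
(* [M l] steps cover more than [T l / 2]; yet [M l * h + eps] stays below [T l], because [eps + h]
   is less than [T l / 2] for [l < k]. *)
pose M l := (Num.truncn (T l / 2 / h)).+1.
have potM l v : (l < k)%N ->
    (\sum_(j < M l) b%:E * mean_weight P X q c r v (j%:R * h) <= (kappa l)%:E)%E.
  move=> lk; apply: le_trans (katoT l v); have /andP[Tl0 Tl1] := T01 l.
  have := htau l lk => tauT; apply: pot => //.
  have [h1 h2] := trn (T l / 2) (ltW (divr_gt0 Tl0 (ltr0Sn _ _))).
  by rewrite /M -natr1 mulrDl mul1r; lra.
pose W l omega := \sum_(i < N) nu i omega * \sum_(j < M l) nu (i + j)%N omega.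
have mpairs (M' : nat) : measurable_fun setT (fun omega =>
    \sum_(i < N) nu i omega * \sum_(j < M') nu (i + j)%N omega).
  apply: measurable_sum => i; apply: measurable_funM => //.
  exact: measurable_sum.
have mW l : measurable_fun setT (W l) by exact: mpairs.
have W0 l omega : 0 <= W l omega.
  by apply: sumr_ge0 => i _; rewrite mulr_ge0// sumr_ge0.
have pairsE (M' : nat) omega : \sum_(i < N) nu i omega * \sum_(j < M') nu (i + j)%N omega =
    \sum_(i < N) b * weight q c r (X (ta + i%:R * h) omega) *
      \sum_(j < M') b * weight q c r (X (ta + i%:R * h + j%:R * h) omega).
  apply: eq_bigr => i _; congr (_ * _); apply: eq_bigr => j _.
  by rewrite /nu natrD mulrDl addrA.
pose S omega := \sum_(i < N) nu i omega.
have mS : measurable_fun setT S by exact: measurable_sum.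
have S0 omega : 0 <= S omega by exact: sumr_ge0.
have ES : (mass_bound%:E <= \int[P x]_omega (S omega)%:E)%E.
  under eq_integral do rewrite -sumEFin.
  rewrite ge0_integral_sum//; last 2 first.
  - by move=> i; exact/measurable_EFinP.
  - by move=> i omega _; rewrite lee_fin.
  pose m0 := b * (fine (w K) * (A * rho (2 * delta) ^+ n * r ^+ n *
    fine (P x (X k0%:R @^-1` ball z0 R0)))).
  apply: (@le_trans _ _ (\sum_(i < N) m0%:E)%E).
    rewrite sumEFin lee_fin sumr_const card_ord -mulr_natl /mass_bound /m0.
    (* The factor [rho eps] cancels between the volume of a ball and the normalisation. *)
    have rr : r ^+ n * beta = A * (C / 6) ^+ n.
      rewrite /r /beta mulrCA -exprMn; congr (_ * _ ^+ _).
      by field; rewrite gt_eqF.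
    rewrite [leRHS](_ : _ = N%:R * h * (r ^+ n * beta) * (fine (w K) *
      (A * rho (2 * delta) ^+ n * fine (P x (X k0%:R @^-1` ball z0 R0))))).
      rewrite rr ler_wpM2r//.
        by rewrite !mulr_ge0 ?fine_ge0 ?exprn_ge0// ltW.
      by rewrite ler_wpM2r// mulr_ge0 ?exprn_ge0 ?divr_ge0// ltW.
    by rewrite /b; ring.
  apply: lee_sum => i _.
  under eq_integral do rewrite EFinM.
  rewrite ge0_integralZl_EFin//; last 3 first.
  - by move=> omega _; rewrite lee_fin weight_ge0.
  - by apply/measurable_EFinP; exact: (measurable_weight markov).
  - exact: ltW.
  rewrite /m0 EFinM; apply: lee_wpmul2l; first by rewrite lee_fin ltW.
  rewrite (integral_weight markov)//.
  (* Every grid time is between [delta] and [2 * delta] after time [k0], when the path is near [z0]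
     with positive probability. *)
  have /andP[ih0 ihd] : 0 <= i%:R * h <= delta.
    rewrite mulr_ge0 ?(ltW h0)//=; apply: le_trans Nd.
    by rewrite ler_pM2r// ler_nat ltnW.
  have d21 : 2 * delta <= 1 by lra.
  have sd : delta <= delta + i%:R * h <= 2 * delta by apply/andP; split; lra.
  have cR l : `|z0 - c l| < R0 by have := KR0 (cK' l); rewrite mx_norm_ball.
  have := mean_weight_ge lebP markov density A0 C0 rho_gt0 rho_le p_low q_ge0 r0 x
    (ler0n _ k0) d0 d21 sd R0_gt0 rR0 R0_d cR.
  rewrite sum_q addrA -/ta /mean_weight.
  rewrite -{1}(fineK (Pfin (ler0n _ k0) (measurable_ball_rV z0 R0))) -!EFinM.
  move=> /le_trans; apply.
  by apply: lee_sum => l _; rewrite setTI.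
have ES2 : (\int[P x]_omega (S omega ^+ 2)%:E <= 2%:E)%E.
  apply: (@le_trans _ _ (\int[P x]_omega (2%:E *
      (\sum_(i < N) nu i omega * \sum_(j < N) nu (i + j)%N omega)%:E))%E).
    apply: ge0_le_integral_nonmeasurable => omega _; rewrite -?EFinM lee_fin.
      exact: sqr_ge0.
    apply: (@block_sqr_le _ (nu^~ omega) N N xpredT) => // i j _ _ iN jN _.
    by rewrite ltn_addl.
  rewrite ge0_integralZl_EFin//; last 2 first.
  - by move=> omega _; rewrite lee_fin sumr_ge0// => i _; rewrite mulr_ge0// sumr_ge0.
  - by apply/measurable_EFinP; exact: mpairs.
  under eq_integral do rewrite pairsE.
  rewrite -[leRHS]mule1 lee_wpmul2l ?lee_fin//.
  have := integral_weight_pairs markov q_ge0 (ltW b0) h0 x ta0 ler01 potN potN.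
  by rewrite mulr1.
have PB := prob_gt_second_moment mS S0 mass_bound_gt0 (ltr0Sn _ 1) ES ES2.
have mB : measurable [set omega | mass_bound / 4 < S omega].
  rewrite (_ : [set _ | _] = setT `&` S @^-1` `]mass_bound / 4, +oo[).
    by apply: mS => //; exact: measurable_itv.
  by apply/seteqP; split => omega /=; rewrite in_itv/= andbT => //; case.
have EW l : (l < k)%N -> (\int[P x]_omega (W l omega)%:E <=
    (pair_tol l * (event_bound / 2 ^+ l.+2))%:E)%E.
  move=> lk; rewrite /W; under eq_integral do rewrite pairsE.
  have := integral_weight_pairs markov q_ge0 (ltW b0) h0 x ta0 (kappa0 l) potN
    (fun v => potM l v lk).
  by rewrite mulr1.
have [G [mG GB PG GW]] := prob_good_event mB (ltW event_bound_gt0) PB mW W0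
  pair_tol_gt0 EW.
exists N, h, nu, G; split => //.
- move=> i omega; rewrite pmulr_rgt0// => /weight_gt0[l cl].
  by exists (c l) => //; rewrite distrC (lt_trans cl).
move=> omega Go; split; first exact: GB.
move=> l lk u v uv; have /andP[Tl0 Tl1] := T01 l.
have tol0 : 0 < block_tol l by rewrite invr_gt0.
rewrite -(@ler_pXn2r _ 2)// ?nnegrE ?sumr_ge0 ?(ltW tol0)//.
pose I (i : nat) := u < ta + i%:R * h <= v.
(* Two grid times in a window of length at most [T l / 2] are fewer than [M l] steps apart. *)
have IM i j : I i -> I j -> (i < N)%N -> (j < N)%N -> (i <= j)%N -> (j < i + M l)%N.
  move=> /andP[ui _] /andP[_ jv] _ _ ij.
  have [_ h2] := trn (T l / 2) (ltW (divr_gt0 Tl0 (ltr0Sn _ _))).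
  rewrite -ltn_subLR// -(ltr_nat R) natrB// -(ltr_pM2r h0) mulrBl.
  by apply: le_lt_trans h2; lra.
apply: le_trans (block_sqr_le (nu0^~ omega) IM) _.
have := GW _ Go _ lk; rewrite /pair_tol ler_pdivlMr//.
by rewrite mulrC.
Qed.

(** The upper limit of the events of [scale_event] has positive probability, and on it
    [hit_of_diffuse_masses] applies path by path. *)
Lemma hits_with_positive_probability (D : set 'rV[R]_n) : cadlag X -> K `<=` D ->
  (0 < (P x)^*%mu [set omega | (hitting_time X D omega < +oo)%E])%E.
Proof.
move=> rc KD; move: delta0 => d0.
have /choice[F HF] (k : nat) : exists F : nat * R * (nat -> Omega -> R) * set Omega,
  [/\ measurable F.2 /\ ((event_bound / 2)%:E <= P x F.2)%E,
      0 < F.1.1.2 /\ F.1.1.1%:R * F.1.1.2 <= delta,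
      forall i omega, 0 <= F.1.2 i omega,
      forall i omega, 0 < F.1.2 i omega ->
        exists2 z, K z & `|X (ta + i%:R * F.1.1.2) omega - z| < k.+1%:R^-1 &
      forall omega, F.2 omega -> mass_bound / 4 < \sum_(i < F.1.1.1) F.1.2 i omega /\
        forall l, (l < k)%N -> forall u v, v - u <= T l / 2 ->
        \sum_(i < F.1.1.1 | u < ta + i%:R * F.1.1.2 <= v) F.1.2 i omega <= block_tol l].
  have [N [h [nu [G HG]]]] := scale_event k.
  by exists (N, h, nu, G).
pose G k := (F k).2.
have mG k : measurable (G k) by have [[]] := HF k.
have PG k : ((event_bound / 2)%:E <= P x (G k))%E by have [[]] := HF k.
have mlim : measurable (lim_sup_set G).
  by apply: bigcapT_measurable => k; exact: bigcup_measurable.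
apply: (@lt_le_trans _ _ (P x (lim_sup_set G))).
  apply: lt_le_trans (prob_lim_sup_set_ge mG PG).
  by rewrite lte_fin divr_gt0// event_bound_gt0.
(* Outer measure is monotone, so it suffices that each path in the measurable upper limit hits
   [D]. *)
rewrite -(measurable_mu_extE (P x) mlim); apply: le_mu_ext => omega Gomega /=.
have ta0 : 0 < ta by rewrite ltr_wpDl.
have archi (e : R) : 0 < e -> exists m : nat, m.+1%:R^-1 <= e.
  move=> e0; exists (Num.truncn e^-1).
  by rewrite ltW// invf_plt ?posrE// truncnS_gt.
have cK' : closed K by apply: compact_closed => //; exact: norm_hausdorff.
have tab : ta <= ta + delta by rewrite lerDl; exact: ltW.
have rcf s : ta <= s -> X t omega @[t --> s^'+] --> X s omega.
  by move=> h; exact: (rc omega s (le_trans (ltW ta0) h)).1.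
have inv0 e : 0 < e -> exists m, forall k, (m <= k)%N -> k.+1%:R^-1 <= e :> R.
  move=> /archi[m me]; exists m => k mk; apply: le_trans me.
  by rewrite lef_pV2 ?posrE// ler_nat.
have tN k i : (i < (F k).1.1.1)%N -> ta <= ta + i%:R * (F k).1.1.2 <= ta + delta.
  move=> iN; have [_ [h0 Nh] _ _ _] := HF k.
  rewrite lerDl mulr_ge0 ?(ltW h0)//= lerD2l; apply: le_trans Nh.
  by rewrite ler_pM2r// ler_nat ltnW.
have nu0 k i : 0 <= (F k).1.2 i omega by have [_ _ + _ _] := HF k.
have nuK k i : 0 < (F k).1.2 i omega ->
    exists2 z, K z & `|X (ta + i%:R * (F k).1.1.2) omega - z| < k.+1%:R^-1.
  by have [_ _ _ + _] := HF k; apply.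
have c0 : 0 < mass_bound / 4 by rewrite divr_gt0// mass_bound_gt0.
have Ginf m : exists2 k, (m <= k)%N & G k omega.
  by have [k mk Gk] := Gomega m I; exists k.
have Gc k : G k omega -> mass_bound / 4 < \sum_(i < (F k).1.1.1) (F k).1.2 i omega.
  by move=> Gk; have [_ _ _ _ /(_ omega Gk)[]] := HF k.
have Gth e : 0 < e -> exists2 th, 0 < th & exists m, forall k, (m <= k)%N ->
    G k omega -> forall u v, v - u <= th ->
    \sum_(i < (F k).1.1.1 | u < ta + i%:R * (F k).1.1.2 <= v) (F k).1.2 i omega <= e.
  move=> /archi[l le]; have /andP[Tl0 _] := T01 l.
  exists (T l / 2); first by rewrite divr_gt0.
  (* Tolerance [l] is in force at every stage [k > l]. *)
  exists l.+1 => k lk Gk u v uv; apply: le_trans le.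
  by have [_ _ _ _ /(_ omega Gk)[_]] := HF k; apply.
have [s /andP[s1 _] Ks] :=
  hit_of_diffuse_masses tab rcf cK' inv0 tN nu0 nuK c0 Ginf Gc Gth.
apply: (@le_lt_trans _ _ s%:E); last exact: ltry.
apply: ereal_inf_lbound; exists s => //=; split; last exact: KD.
exact: lt_le_trans s1.
Qed.

End at_one_scale.
End hitting.

(** * Local finiteness of Kato measures and the non-polarity theorem *)

(** On this ball the density is bounded below by a positive constant for all times between [delta]
    and [2 * delta]. Infinite mass would make the inner integral infinite there, and the potential
    would exceed [1]. *)
Lemma kato_locally_finite (R : realType) (n : nat)
    (p : R -> 'rV[R]_n -> 'rV[R]_n -> R) (A C : R) (rho : R -> R)
    (w : {measure set 'rV[R]_n -> \bar R}) (z : 'rV[R]_n) (delta : R) :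
  0 < A -> 0 < C ->
  (forall t, 0 < t <= 1 -> 0 < rho t) ->
  (forall s t, 0 < s -> s <= t -> t <= 1 -> rho t <= rho s) ->
  (forall t x, 0 < t -> continuous (p t x)) ->
  (forall t x y, 0 < t <= 1 -> 0 <= p t x y) ->
  (forall t x y, 0 < t <= 1 -> `|y - x| <= C / rho t ->
    A * rho t ^+ n <= p t x y) ->
  0 < delta -> 4 * delta <= 1 ->
  (\int[lebesgue_measure]_(s in `]0%R, (4 * delta)%R[)
     \int[w]_y (p s z y)%:E <= 1)%E ->
  (w (ball z (C / rho delta / 3)) < +oo)%E.
Proof.
move=> A0 C0 rho_gt0 rho_le pc p_ge0 p_low d0 d1 kato.
rewrite ltey; apply/eqP => woo; move: kato; apply/negP; rewrite -ltNge.
pose I : set R := `]delta, 2 * delta[%classic.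
have mI : measurable I by exact: measurable_itv.
have k0 : 0 <= 2 / delta by rewrite divr_ge0// ltW.
(* A step function of height [2 / delta] on an interval of length [delta] has integral [2], and it
   lies below the infinite inner integral. *)
apply: (@lt_le_trans _ _ (\int[lebesgue_measure]_(s in `]0%R, (4 * delta)%R[)
    ((2 / delta) * \1_I s)%:E)%E).
  under eq_integral do rewrite EFinM.
  rewrite ge0_integralZl_EFin//; last first.
    by apply/measurable_EFinP; apply: measurable_indic.
  rewrite integral_indic// setIidl; last first.
    move=> s; rewrite /I /= !in_itv/= => /andP[s1 s2].
    by apply/andP; split; lra.
  have leI : lebesgue_measure I = delta%:E.
    rewrite /I lebesgue_measure_itv/= lte_fin ifT; last by lra.
    by rewrite -EFinD; congr EFin; lra.
  rewrite [X in (_ < _ * X)%E]leI -EFinM lte_fin divfK ?gt_eqF//.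
  by rewrite ltr1n.
apply: ge0_le_integral_nonmeasurable => s; rewrite /= in_itv/= => /andP[s0 s4].
  by rewrite lee_fin mulr_ge0.
have s01 : 0 < s <= 1 by apply/andP; split; lra.
have d01 : 0 < delta <= 1 by apply/andP; split; lra.
have p0 y : (0 <= (p s z y)%:E)%E by rewrite lee_fin p_ge0.
rewrite indicE; case: (boolP (s \in I)) => [|_]; last first.
  by rewrite mulr0; apply: integral_ge0.
rewrite inE /I /= in_itv/= mulr1 => /andP[s1 s2].
have rs := rho_gt0 s s01; have rd := rho_gt0 delta d01.
apply: (@le_trans _ _ (\int[w]_(y in ball z (C / rho delta / 3)) (p s z y)%:E)%E);
    last first.
  apply: ge0_subset_integral => //; first exact: measurable_ball_rV.
  by apply/measurable_EFinP; apply: continuous_measurable_rV; exact: pc.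
apply: (@le_trans _ _ (\int[w]_(y in ball z (C / rho delta / 3))
    (A * rho s ^+ n)%:E)%E).
  rewrite integral_cst; last exact: measurable_ball_rV.
  rewrite [X in (_ <= _ * X)%E]woo gt0_muley ?leey//.
  by rewrite lte_fin mulr_gt0// exprn_gt0.
apply: ge0_le_integral_nonmeasurable => y.
  by move=> _; rewrite lee_fin mulr_ge0 ?exprn_ge0// ltW.
rewrite mx_norm_ball /ball_/= lee_fin distrC => zy; apply: p_low => //.
have rsd : rho s <= rho delta by apply: rho_le; lra.
have h1 : C / rho delta <= C / rho s by rewrite ler_pM2l// lef_pV2.
have h2 : 0 < C / rho delta by rewrite divr_gt0.
by lra.
Qed.

Theorem corollary3p6 (R : realType) (n : nat)
  (leb : {measure set 'rV[R]_n -> \bar R})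
  (mu : {measure set 'rV[R]_n -> \bar R})
  (a : 'rV[R]_n -> 'rV[R]_n) (m : 'rV[R]_n -> 'rV[R]_n -> R)
  (d : measure_display) (Omega : measurableType d)
  (P : 'rV[R]_n -> probability Omega R) (X : R -> Omega -> 'rV[R]_n)
  (p : R -> 'rV[R]_n -> 'rV[R]_n -> R)
  (D : set 'rV[R]_n) (varpi : {measure set 'rV[R]_n -> \bar R})
  (leb_lebesgue : is_lebesgue leb)
  (mu_levy : levy_measure mu)
  (mu_neq0 : mu setT <> 0%E)
  (a_measurable : measurable_fun setT a)
  (m_measurable : measurable_fun setT
     (fun z : 'rV[R]_n * 'rV[R]_n => m z.1 z.2))
  (m_gt0 : forall x h, 0 < m x h)
  (A_holds : assumptionA mu a m)
  (X_feller : feller_process P X)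
  (X_generator : forall f : 'rV[R]_n -> R,
     C2_infty f -> generator P X f (levy_op mu a m f))
  (p_density : transition_density P X leb p)
  (p_bounds : density_bounds mu p)
  (varpi_kato : kato_class p varpi)
  (varpi_support : msupport varpi = closure D)
  (varpi_carried : varpi.-negligible (~` D))
  (D_neq0 : D !=set0) :
  forall x : 'rV[R]_n,
    (0 < (P x)^*%mu [set omega | (hitting_time X D omega < +oo)%E])%E.
Proof.
move=> x.
(* In dimension zero the whole space is the origin, which a Lévy measure does not charge. *)
have n_gt0 : (0 < n)%N.
  rewrite lt0n; apply/eqP => n0; apply: mu_neq0; have [mu0 _] := mu_levy.
  rewrite -mu0; congr (mu _); apply/seteqP; split => // y _ /=.
  by apply/rowP => -[i /[dup]]; rewrite {1}n0.
have [markov rc _ _] := X_feller.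
have [a1 [a2 [a3 [a4 [Q [a1_gt0 a2_gt0 _ _ pb]]]]]] := p_bounds.
have f_low_ge0 z : 0 <= f_low a1 a2 z.
  by rewrite mulr_ge0 ?(ltW a1_gt0)// le_max lexx orbT.
have p_ge0 t y z : 0 < t <= 1 -> 0 <= p t y z.
  move=> t01; have [+ _] := pb t y z t01; apply: le_trans.
  by rewrite mulr_ge0// exprn_ge0// rho_ge0.
(* If [rho mu t = 0], in particular if the infimum is over the empty set, then the
   upper bound makes the density vanish. *)
have rho_gt0 t : 0 < t <= 1 -> 0 < rho mu t.
  move=> t01; rewrite lt0r rho_ge0 andbT; apply/eqP => rho0.
  have /andP[t0 _] := t01.
  have := p_density.1 t x setT t0 measurableT.
  rewrite preimage_setT probability_setT integral0_eq.
    by case=> /eqP; rewrite oner_eq0.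
  move=> y _; apply/eqP; rewrite eq_le !lee_fin p_ge0// andbT.
  have [_] := pb t x y t01.
  by rewrite rho0 expr0n gtn_eqF// mul0e lee_fin.
have rho_le s t : 0 < s -> s <= t -> t <= 1 -> rho mu t <= rho mu s.
  move=> s0 st t1; apply: rho_nonincreasing => //; apply: rho_gt0.
  by rewrite s0 (le_trans st).
have rho_infty M : 0 < M -> exists2 t0, 0 < t0 &
    forall t, 0 < t -> t < t0 -> t <= 1 -> M <= rho mu t.
  move=> /(rho_pinfty mu_levy)[t0 t00 h]; exists t0 => // t tpos tt0 t1.
  by apply: h => //; apply: rho_gt0; rewrite tpos.
have nR : 0 < n%:R :> R by rewrite ltr0n.
(* With this [C] the argument of [f_low] has Euclidean norm at most [1 / (2 * a2)], where [f_low] is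
   at least [a1 / 2]; the factor [n] compares the two norms. *)
pose A := a1 / 2; pose C := (2 * a2 * n%:R)^-1.
have A_gt0 : 0 < A by rewrite divr_gt0.
have C_gt0 : 0 < C by rewrite invr_gt0 !mulr_gt0.
have p_low t y z : 0 < t <= 1 -> `|z - y| <= C / rho mu t ->
    A * rho mu t ^+ n <= p t y z.
  move=> t01 yz; have [+ _] := pb t y z t01; apply: le_trans.
  have rt := rho_gt0 t t01.
  rewrite mulrC ler_wpM2l ?exprn_ge0 ?(ltW rt)// /A /f_low ler_pM2l//.
  rewrite le_max; apply/orP; left.
  have : a2 * enorm (rho mu t *: (z - y)) <= 2^-1.
    rewrite -ler_pdivlMl//; apply: le_trans (enorm_le _) _.
    rewrite normrZ gtr0_norm// -ler_pdivlMl// mulrC -ler_pdivlMr//.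
    rewrite (le_trans yz)// ler_pM2r ?invr_gt0// /C.
    by rewrite le_eqVlt; apply/orP; left; apply/eqP; field; rewrite !gt_eqF.
  by lra.
have kato e : 0 < e -> exists2 T, 0 < T <= 1 & forall y,
    (\int[lebesgue_measure]_(s in `]0%R, T[) \int[varpi]_z (p s y z)%:E <= e%:E)%E.
  move=> e0; have [|q /= q0 hq] := varpi_kato [set u | (u < e%:E)%E].
    by apply: open_nbhs_nbhs; split;
      [exact: open_ereal_lt_ereal|rewrite /= lte_fin].
  have T0 : 0 < Num.min (q / 2) 1 by rewrite lt_min ltr01 divr_gt0.
  exists (Num.min (q / 2) 1); first by rewrite T0 ge_min lexx orbT.
  move=> y; apply: ltW; apply: le_lt_trans (hq _ _ T0).
    by apply: ereal_sup_ubound; exists y.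
  rewrite /ball_/= sub0r normrN gtr0_norm//.
  have : Num.min (q / 2) 1 <= q / 2 by rewrite ge_min lexx.
  by lra.
have [T1 /andP[T10 T11] kato1] := kato 1 ltr01.
pose delta := T1 / 4.
have delta_gt0 : 0 < delta by rewrite divr_gt0.
have delta4 : 4 * delta = T1 by rewrite /delta; lra.
have delta1 : 4 * delta <= 1 by rewrite delta4.
rewrite -delta4 in kato1.
have [z0 Dz0] := D_neq0.
pose U := ball z0 (C / rho mu delta / 3).
have R0_gt0 : 0 < C / rho mu delta / 3.
  by rewrite !divr_gt0// rho_gt0//; apply/andP; split; lra.
have varpiU0 : (0 < varpi U)%E.
  have : msupport varpi z0 by rewrite varpi_support; exact: subset_closure.
  by apply; [exact: ball_open|exact: ballxx].
have varpiUoo : (varpi U < +oo)%E.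
  apply: (kato_locally_finite (p := p) (A := A)) => //.
  by move=> t y t0; exact: (transition_density_continuous p_density).
(* A measurable null set covering the complement of [D] is removed from [U], so that the compact set
   found in the rest lies in [D] itself and not merely in its closure. *)
have [N [mN N0 DN]] := varpi_carried.
have mU : measurable U by exact: measurable_ball_rV.
have mUN : measurable (U `\` N) by exact: measurableD.
have varpiUN : varpi (U `\` N) = varpi U.
  apply/eqP; rewrite eq_le; apply/andP; split.
    by apply: le_measure; rewrite ?inE// => y [].
  apply: (@le_trans _ _ (varpi ((U `\` N) `|` N))).
    apply: le_measure; rewrite ?inE//; first exact: measurableU.
    by move=> y Uy; have [Ny|Ny] := pselect (N y); [right|left].
  by rewrite (le_trans (measureU2 _ _ _))// [X in (_ + X)%E]N0 adde0.
have [|K [cK KUN K0]] := closed_subset_pos_measure (w := varpi) mUN.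
  by rewrite varpiUN varpiU0.
have mK := closed_measurable_rV cK.
have KU : K `<=` U by move=> y /KUN[].
have KD : K `<=` D.
  by move=> y /KUN[_ Ny]; apply: contrapT => Dy; apply: Ny; exact: DN.
have Koo : (varpi K < +oo)%E.
  by apply: le_lt_trans varpiUoo; apply: le_measure; rewrite ?inE.
have Kcompact : compact K.
  apply: bounded_closed_compact cK.
  exists (`|z0| + C / rho mu delta / 3); split; first exact: num_real.
  move=> M hM y /KU; rewrite /U mx_norm_ball /ball_/= distrC => zy.
  have := ler_normD (y - z0) z0; rewrite subrK => h.
  by rewrite (le_trans h)// ltW// (lt_trans _ hM)// addrC ltrD2l.
have [k0 hk0] := process_reaches_ball leb_lebesgue markov p_density A_gt0 C_gt0
  rho_gt0 p_low x z0 R0_gt0.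
have eb := event_bound_gt0 markov A_gt0 C_gt0 rho_gt0 delta_gt0 delta1 K0 Koo hk0.
(* The times [T l] are fixed after [event_bound], which depends on [K] and [k0] but on no
   discretisation scale. *)
have /choice[T hT] (l : nat) : exists T, 0 < T <= 1 /\ forall y,
    (\int[lebesgue_measure]_(s in `]0%R, T[) \int[varpi]_z (p s y z)%:E <=
     (pair_tol R l * (event_bound P X A C (rho mu) varpi x z0 delta k0 K
       / 2 ^+ l.+2))%:E)%E.
  have [|T T01 h] := kato (pair_tol R l * (event_bound P X A C (rho mu) varpi x z0
    delta k0 K / 2 ^+ l.+2)); last by exists T.
  by rewrite mulr_gt0 ?pair_tol_gt0// divr_gt0// exprn_gt0.
exact: (hits_with_positive_probability leb_lebesgue markov p_density A_gt0 C_gt0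
  rho_gt0 rho_le rho_infty p_ge0 p_low delta_gt0 delta1 kato1 Kcompact mK KU K0 Koo
  hk0 (fun l => (hT l).1) (fun l => (hT l).2) rc KD).
Qed.
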